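(* Let $f$ be an operator convex function on an interval $I\subseteq\mathbb{R}$ and $A,B\in\mathcal{SA}_I(H)$, where $H$ is a Hilbert space, while $p:[0,1]\to\mathbb{R}$ is symmetric, i.e. $p(1-t)=p(t)$ for all $t\in[0,1]$, and non-decreasing on $[0,1/2]$. (i) If $p$ is differentiable on $(0,1)$ and $f\in\mathcal{G}([A,B])$, then in the operator order \[ 0\le \int_0^1 p(t)\,dt\int_0^1 f\big(tA+(1-t)B\big)\,dt-\int_0^1 p(t) f\big(tA+(1-t)B\big)\,dt \le \frac1{24}\|p'\|_\infty\left[\nabla f_B(B-A)-\nabla f_A(B-A)\right]. \] (ii) If $p$ is differentiable on $(0,1)$ with $p'\in L_2[0,1]$ and $f\in\mathcal{G}([A,B])$, then in the operator order \[ 0\le \int_0^1 p(t)\,dt\int_0^1 f\big(tA+(1-t)B\big)\,dt-\int_0^1 p(t) f\big(tA+(1-t)B\big)\,dt \] \[ \le \frac{1}{2\pi^2}\|p'\|_2\left(\int_0^1\left\|\nabla f_{(1-t)A+tB}(B-A)-\nabla f_{tA+(1-t)B}(B-A)\right\|^2dt\right)^{1/2}1_H \] \[ \le \frac{1}{\pi^2}\|p'\|_2\left(\int_0^1\left\|\nabla f_{(1-t)A+tB}(B-A)\right\|^2dt\right)^{1/2}1_H, \] provided the last integral is finite.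
   Context: $\mathcal{SA}_I(H)$ denotes the class of all selfadjoint operators on $H$ with spectra in $I$, $\mathcal{B}(H)$ the bounded linear operators on $H$, $1_H$ the identity operator, and $\|\cdot\|$ applied to operators is the operator norm. For a continuous function $f$ on $I$ and $T\in\mathcal{SA}_I(H)$, $f(T)$ is defined by the continuous functional calculus, and the corresponding function of operators $\mathcal{SA}_I(H)\to\mathcal{B}(H)$ is denoted by the same letter $f$. The operator order is: $S\le T$ iff $\langle Sx,x\rangle\le\langle Tx,x\rangle$ for all $x\in H$. A real valued continuous function $f$ on $I$ is operator convex on $I$ if $f((1-\lambda)S+\lambda T)\le(1-\lambda)f(S)+\lambda f(T)$ in the operator order for all $\lambda\in[0,1]$ and all selfadjoint operators $S,T$ on a Hilbert space $H$ whose spectra are contained in $I$. $\|p'\|_\infty$ denotes the supremum norm $\sup_{t\in(0,1)}|p'(t)|$ and $\|p'\|_2=\left(\int_0^1|p'(t)|^2dt\right)^{1/2}$. For two distinct operators $A,B\in\mathcal{SA}_I(H)$, the segment is $[A,B]:=\{(1-t)A+tB : t\in[0,1]\}\subset\mathcal{SA}_I(H)$. A continuous function $g:\mathcal{SA}_I(H)\to\mathcal{B}(H)$ is Gâteaux differentiable in $T\in\mathcal{SA}_I(H)$ along the direction $S\in\mathcal{B}(H)$ if the limit \[ \nabla g_T(S):=\lim_{s\to0}\frac{g(T+sS)-g(T)}{s}\in\mathcal{B}(H) \] exists in the strong topology of $\mathcal{B}(H)$. If this limit exists for all $S\in\mathcal{B}(H)$, then $g$ is said to be Gâteaux differentiable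 in $T$, written $g\in\mathcal{G}(T)$. If this is true for every $T$ in a set $\mathcal{S}\subset\mathcal{SA}_I(H)$, one writes $g\in\mathcal{G}(\mathcal{S})$; thus $f\in\mathcal{G}([A,B])$ means that $f$ is Gâteaux differentiable in every $T\in[A,B]$. *)

(* Defs.v *)
From HB Require Import structures.
From mathcomp Require Import all_boot all_order all_algebra.
From mathcomp Require Export complex.
From mathcomp Require Import all_classical all_reals all_analysis.

Set Implicit Arguments.
Unset Strict Implicit.
Unset Printing Implicit Defensive.
Import Order.TTheory GRing.Theory Num.Theory numFieldNormedType.Exports.
Local Open Scope classical_set_scope.
Local Open Scope ring_scope.
Local Open Scope complex_scope.

(* Complex Hilbert spaces. The inner product is linear in its first argument
   and induces the norm, for which the space is complete. *)
Record hilbertType (R : realType) := HilbertType {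
  hilbert_sort :> completeNormedModType R[i] ;
  hdot : {dot hilbert_sort for (@Num.conj R[i])} ;
  hdot_norm : forall x : hilbert_sort, hdot x x = `|x| ^+ 2 }.

Notation "'[< x , y >]" := (hdot _ x y)
  (at level 0, x at level 99, y at level 99) : ring_scope.

(* B(H) is carved out of the function space H -> H, whose pointwise linear
   structure provides sums and scalar multiples; 1_H is idfun. *)
Section Operators.
Context {R : realType} {H : hilbertType R}.
Implicit Types (S T V L : H -> H) (I : interval R) (f : R -> R).

Definition bounded_op : set (H -> H) :=
  [set T | linear T /\ continuous T].

(* The norm of H takes its values in R[i] (on the nonnegative real axis). *)
Definition opnorm T : R := sup [set complex.Re `|T x| | x in [set x | `|x| <= 1]].

Definition op_le S T := forall x : H, '[< S x, x >] <= '[< T x, x >].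

Definition spectrum T : set R[i] :=
  [set z | ~ exists S, [/\ bounded_op S,
     (T - z *: idfun) \o S = idfun & S \o (T - z *: idfun) = idfun]].

Definition selfadjoint : set (H -> H) :=
  [set T | bounded_op T /\ forall x y, '[< T x, y >] = '[< x, T y >]].

Definition SA I : set (H -> H) :=
  [set T | selfadjoint T /\ spectrum T `<=` [set t%:C | t in [set` I]]].

Definition poly_op (q : {poly R}) T : H -> H :=
  \sum_(i < size q) (q`_i)%:C *: iter i T.

(* Continuous functional calculus of a selfadjoint operator: the extension by
   continuity, from polynomials to C(spectrum T), of q |-> q(T). The limit is
   unique because |q(T)| is the supremum of |q| over the spectrum. *)
Definition is_cfc f T V :=
  bounded_op V /\ exists q : nat -> {poly R},
    (forall e : R, 0 < e -> \forall n \near \oo,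
       forall t : R, spectrum T t%:C -> `|f t - (q n).[t]| <= e) /\
    (fun n => opnorm (V - poly_op (q n) T)) @ \oo --> (0 : R).

Definition cfc f T : H -> H := xget 0 [set V | is_cfc f T V].

Definition segment (A B : H -> H) : set (H -> H) :=
  [set (1 - t)%:C *: A + t%:C *: B | t in `[0%R, 1%R]].

(* The difference quotient only makes sense for those s with T + sS in the
   domain SA I of g, so the limit is taken along these s. At an endpoint of a
   segment this may be a one-sided limit; directions along which T cannot be
   perturbed inside SA I carry no condition. *)
Definition is_gateaux I (g : (H -> H) -> (H -> H)) T S L :=
  bounded_op L /\ forall x : H,
    (fun s : R => (s^-1)%:C *: (g (T + s%:C *: S) x - g T x))
      @ within [set s : R | SA I (T + s%:C *: S)] 0^' --> L x.

Definition gateaux_at I g T :=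
  forall S, bounded_op S -> exists L, is_gateaux I g T S L.

Definition gateaux_on I g (D : set (H -> H)) :=
  forall T, D T -> gateaux_at I g T.

Definition nabla I g T S : H -> H := xget 0 [set L | is_gateaux I g T S L].

Record op_simple := OpSimple {
  simple_size : nat ;
  simple_set : 'I_simple_size -> set R ;
  simple_val : 'I_simple_size -> H -> H ;
  simple_set_sub : forall i, simple_set i `<=` `[0%R, 1%R] ;
  simple_set_measurable : forall i, measurable (simple_set i) ;
  simple_val_bounded : forall i, bounded_op (simple_val i) }.

Definition simple_fun (s : op_simple) (t : R) : H -> H :=
  \sum_i (\1_(@simple_set s i) t)%:C *: @simple_val s i.

Definition simple_integral (s : op_simple) : H -> H :=
  \sum_i (fine (lebesgue_measure (@simple_set s i)))%:C *: @simple_val s i.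

(* V is the Bochner integral of F : [0, 1] -> B(H) for the Lebesgue measure. *)
Definition is_op_integral (F : R -> H -> H) V :=
  [/\ bounded_op V,
      forall t, t \in `[0%R, 1%R] -> bounded_op (F t) &
      exists s : nat -> op_simple,
      [/\ forall n, measurable_fun (`[0%R, 1%R] : set R)
            (fun t : R => opnorm (F t - simple_fun (s n) t)),
          (fun n => \int[lebesgue_measure]_(t in `[0%R, 1%R])
             (opnorm (F t - simple_fun (s n) t))%:E)%E @ \oo --> 0%E &
          (fun n => opnorm (V - simple_integral (s n))) @ \oo --> (0 : R)]].

Definition op_integral (F : R -> H -> H) : H -> H :=
  xget 0 [set V | is_op_integral F V].

End Operators.

Arguments op_simple {R} H.

Definition operator_convex (R : realType) (I : interval R) (f : R -> R) :=
  {within [set` I], continuous f} /\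
  forall (H : hilbertType R) (S T : H -> H) (l : R),
    SA I S -> SA I T -> l \in `[0%R, 1%R] ->
    op_le (cfc f ((1 - l)%:C *: S + l%:C *: T))
          ((1 - l)%:C *: cfc f S + l%:C *: cfc f T).

(* |p'| over the open interval, where p' is meaningful. *)
Definition abs_deriv_values (R : realType) (p : R -> R) : set R :=
  [set `|derive1 p t| | t in (`]0%R, 1%R[ : set R)].

Definition deriv_in_L2 (R : realType) (p : R -> R) :=
  measurable_fun (`]0%R, 1%R[ : set R) (derive1 p) /\
  (\int[lebesgue_measure]_(t in `]0%R, 1%R[) (`|derive1 p t| ^+ 2)%:E < +oo)%E.

Definition deriv_norm2 (R : realType) (p : R -> R) : R :=
  Num.sqrt (\int[lebesgue_measure]_(t in `]0%R, 1%R[) (`|derive1 p t| ^+ 2))%R.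

(* Main.v *)
From HB Require Import structures.
Require Import Defs.
From mathcomp Require Import all_boot all_order all_algebra.
From mathcomp Require Import all_classical all_reals all_analysis.
From mathcomp Require Import measurable_realfun ring lra.

Set Implicit Arguments.
Unset Strict Implicit.
Unset Printing Implicit Defensive.
Import Order.TTheory GRing.Theory Num.Theory numFieldNormedType.Exports.
Local Open Scope classical_set_scope.
Local Open Scope ring_scope.
Local Open Scope complex_scope.

(* For every x, phi(t) = <f((1 - t) A + t B) x, x> is convex with derivative
   <nabla f (B - A) x, x>. With v(t) = - (phi(t) + phi(1 - t)), the quadratic form of
   the operator to be bounded is half the Chebyshev functional of p and v. Both are
   symmetric about 1/2 and nondecreasing on [0, 1/2], hence similarly ordered, so
   Chebyshev's inequality makes it nonnegative and Gruss' inequality bounds it by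
   osc(p) osc(v) / 8. Here osc(p) is at most half the sup norm and half the L2 norm
   of p', and osc(v) at most (phi'(1) - phi'(0)) / 2 and half the L2 norm of v'. This
   gives the constant 1/32, which is below 1/24, and below 1/(2 pi^2) as pi <= 4. *)

(** * Hilbert spaces and bounded operators *)

(** Several things must be in place before the scalar argument applies. The segment has to stay
    inside [SA I]: this rests on the extreme values of a selfadjoint form being spectral values, so
    that bounds on forms become bounds on spectra. The integrals are Bochner integrals of operators:
    they exist because convexity confines the rate of each form of the path between its two end
    derivatives, which makes the path Lipschitz in operator norm, while [p] is measurable by
    monotonicity. Pairing with [x] then gives scalar integrals. In (ii) the derivatives exist
    pointwise, and nothing says that integrating them recovers the functions. The replacement is the
    one-sided inequality [dini_integral_le], which asks only for local bounds on slopes. For the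
    convex part the bound is the norm of the gap of the derivative between [t] and [1 - t],
    measurable because the derivatives increase in the operator order. The oscillations carry a
    factor [1 / 2] because a symmetric function makes its whole climb on one half of the interval.
    All estimates are for a fixed [x] and homogeneous of degree two in it, hence they are operator
    inequalities. *)

Section Hilbert.
Context {R : realType} {H : hilbertType R}.
Implicit Types (x y z : H) (a : R).

Definition nm x : R := complex.Re `|x|.

(** A real inner product with the same norm: inequalities are proved over [R] and carried to [R[i]]
    only at the end. *)
Definition rdot x y : R := complex.Re '[< x, y >].

Lemma normE x : `|x| = (nm x)%:C.
Proof.
have /complex_realP[k hk] : `|x| \is Num.real by exact: normr_real.
by rewrite /nm hk.
Qed.

Lemma nm_ge0 x : 0 <= nm x.
Proof. by rewrite -ler0c -normE. Qed.

Lemma nm0 : nm 0 = 0. Proof. by rewrite /nm normr0. Qed.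

Lemma nm_eq0 x : nm x = 0 -> x = 0.
Proof. by move=> x0; apply/normr0_eq0; rewrite normE x0. Qed.

Lemma nmN x : nm (- x) = nm x. Proof. by rewrite /nm normrN. Qed.

Lemma nm_sub x y : nm (x - y) = nm (y - x).
Proof. by rewrite -nmN opprB. Qed.

Lemma nmD x y : nm (x + y) <= nm x + nm y.
Proof. by rewrite -lecR rmorphD /= -!normE ler_normD. Qed.

Lemma normcR a : `|a%:C : R[i]| = `|a|%:C.
Proof. by rewrite normc_def /= expr0n addr0 sqrtr_sqr. Qed.

Lemma nmZ a x : nm (a%:C *: x) = `|a| * nm x.
Proof. by apply: complexI; rewrite -normE normrZ normE normcR rmorphM. Qed.

Lemma rdotxx x : rdot x x = nm x ^+ 2.
Proof. by rewrite /rdot hdot_norm normE -rmorphXn. Qed.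

Lemma rdotDl x y z : rdot (x + y) z = rdot x z + rdot y z.
Proof. by rewrite /rdot linearDl raddfD. Qed.

Lemma rdotNl x y : rdot (- x) y = - rdot x y.
Proof. by rewrite /rdot linearNl raddfN. Qed.

Lemma ReZ a (w : R[i]) : complex.Re (a%:C * w) = a * complex.Re w.
Proof. by case: w => p q /=; rewrite mul0r subr0. Qed.

Lemma rdotZl a x y : rdot (a%:C *: x) y = a * rdot x y.
Proof. by rewrite /rdot linearZl_LR ReZ. Qed.

Lemma rdotC x y : rdot x y = rdot y x.
Proof.
rewrite /rdot (@hermC) expr0 mul1r.
by have -> // : forall w : R[i], complex.Re (Num.conj w) = complex.Re w; case.
Qed.

Lemma rdotDr x y z : rdot x (y + z) = rdot x y + rdot x z.
Proof. by rewrite rdotC rdotDl !(rdotC x). Qed.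

Lemma rdotNr x y : rdot x (- y) = - rdot x y.
Proof. by rewrite rdotC rdotNl rdotC. Qed.

Lemma rdotZr a x y : rdot x (a%:C *: y) = a * rdot x y.
Proof. by rewrite rdotC rdotZl rdotC. Qed.

Lemma rdotBl x y z : rdot (x - y) z = rdot x z - rdot y z.
Proof. by rewrite rdotDl rdotNl. Qed.

Lemma rdotBr x y z : rdot x (y - z) = rdot x y - rdot x z.
Proof. by rewrite rdotDr rdotNr. Qed.

Lemma rdot0l x : rdot 0 x = 0.
Proof. by rewrite -[0](subrr x) rdotBl subrr. Qed.

Lemma rdot0r x : rdot x 0 = 0.
Proof. by rewrite rdotC rdot0l. Qed.

Lemma rdot_suml (J : Type) (r : seq J) (P : pred J) (u : J -> H) y :
  rdot (\sum_(i <- r | P i) u i) y = \sum_(i <- r | P i) rdot (u i) y.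
Proof.
by apply: (big_morph (rdot^~ y)) => [u1 u2|]; rewrite ?rdotDl ?rdot0l.
Qed.

(** By conjugate linearity in the second argument [<x, i y> = - i <x, y>], whose real part is the
    imaginary part of [<x, y>]. *)
Lemma hdot_Re_Im x y : '[< x, y >] = rdot x y +i* rdot x ('i%C *: y).
Proof.
rewrite {2}/rdot linearZr_LR /= /rdot.
by case: (hdot _ x y) => p q /=; rewrite mul0r mulN1r opprK add0r.
Qed.

Lemma nmB_sqr x y : nm (x - y) ^+ 2 = nm x ^+ 2 - 2 * rdot x y + nm y ^+ 2.
Proof. by rewrite -!rdotxx rdotBl !rdotBr (rdotC y x); ring. Qed.

Lemma nmD_sqr x y : nm (x + y) ^+ 2 = nm x ^+ 2 + 2 * rdot x y + nm y ^+ 2.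
Proof. by rewrite -!rdotxx rdotDl !rdotDr (rdotC y x); ring. Qed.

(** Cauchy-Schwarz: expand the squared norm of [|y| x - |x| y] and divide by [2 |x| |y|]. *)
Lemma rdot_le x y : rdot x y <= nm x * nm y.
Proof.
have [/nm_eq0->|y0] := eqVneq (nm y) 0; first by rewrite rdot0r nm0 mulr0.
have [/nm_eq0->|x0] := eqVneq (nm x) 0; first by rewrite rdot0l nm0 mul0r.
have {}y0 : 0 < nm y by rewrite lt_def y0 nm_ge0.
have {}x0 : 0 < nm x by rewrite lt_def x0 nm_ge0.
have := sqr_ge0 (nm ((nm y)%:C *: x - (nm x)%:C *: y)).
rewrite nmB_sqr rdotZl rdotZr !nmZ (ger0_norm (ltW x0)) (ger0_norm (ltW y0)).
move=> h; have xy0 := mulr_gt0 x0 y0.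
by rewrite -(ler_pM2l xy0); lra.
Qed.

Lemma rdot_abs_le x y : `|rdot x y| <= nm x * nm y.
Proof.
by rewrite ler_norml rdot_le andbT lerNl -rdotNl -(nmN x) rdot_le.
Qed.

(** A positive element of [R[i]] has no imaginary part; this turns complex tolerances into real
    ones. *)
Lemma ltcr_gt0 (r : R) (e : R[i]) : 0 < e -> (r%:C < e) = (r < complex.Re e).
Proof. by case: e => p q; rewrite !ltcE /= => /andP[/eqP-> _]; rewrite eqxx. Qed.

Lemma Re_gt0 (e : R[i]) : 0 < e -> 0 < complex.Re e.
Proof. by move=> e0; rewrite -ltcr_gt0. Qed.

Lemma cvg_nm (T : Type) (F : set_system T) (u : T -> H) (l : H) : Filter F ->
  (u @ F --> l) <-> (forall e : R, 0 < e -> \forall t \near F, nm (l - u t) < e).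
Proof.
move=> FF; split => [/cvgrPdist_lt h e e0|h].
  have e0' : 0 < e%:C :> R[i] by rewrite ltcR.
  by apply: filterS (h _ e0') => t; rewrite normE ltcR.
apply/cvgrPdist_lt => e e0.
by have := h _ (Re_gt0 e0); apply: filterS => t; rewrite normE ltcr_gt0.
Qed.

Lemma nm_cauchy_cvg (u : nat -> H) :
  (forall e : R, 0 < e -> \forall n \near \oo, forall m, (n <= m)%N ->
     nm (u n - u m) < e) -> cvgn u.
Proof.
move=> h; apply: cauchy_cvg; apply: cauchy_exP => e e0.
have [N _ hN] := h _ (Re_gt0 e0).
exists (u N); exists N => // m /= Nm.
by rewrite -ball_normE /= normE ltcr_gt0//; exact: hN N (leqnn N) m Nm.
Qed.

End Hilbert.

(** * Bounded and selfadjoint operators, their norms and quadratic forms *)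

Section Operators.
Context {R : realType} {H : hilbertType R}.
Implicit Types (x y z : H) (a k : R) (S T V : H -> H).

Lemma addopE S T x : (S + T) x = S x + T x. Proof. by []. Qed.

Lemma oppopE T x : (- T) x = - T x. Proof. by []. Qed.

Lemma subopE S T x : (S - T) x = S x - T x. Proof. by []. Qed.

Lemma scaleopE (c : R[i]) T x : (c *: T) x = c *: T x. Proof. by []. Qed.

Lemma sumopE (J : Type) (r : seq J) (P : pred J) (U : J -> H -> H) x :
  (\sum_(j <- r | P j) U j) x = \sum_(j <- r | P j) U j x.
Proof. exact: (big_morph (fun T : H -> H => T x)). Qed.

Definition opE := (subopE, addopE, oppopE, scaleopE, sumopE).

Lemma bounded_opP T : bounded_op T <->
  linear T /\ exists2 k : R, 0 <= k & forall x, nm (T x) <= k * nm x.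
Proof.
split=> [[linT ctT]|[linT [k k0 hk]]]; split=> //.
  pose L : {linear H -> H} := HB.pack T (GRing.isLinear.Build _ _ _ _ T linT).
  have /linear_boundedP/pinfty_ex_gt0[r r0 hr] : bounded_near L (nbhs (0 : H)).
    by apply: continuous_linear_bounded; exact: ctT.
  have rr : r = (complex.Re r)%:C by rewrite RRe_real// gtr0_real.
  exists (complex.Re r); first by rewrite -ler0c -rr ltW.
  by move=> x; rewrite -lecR rmorphM /= -rr -!normE; exact: hr.
move=> x; apply/cvg_nm => e e0.
have k1 : 0 < k + 1 by rewrite ltr_wpDl.
have : y @[y --> x] --> x by [].
move/cvg_nm/(_ (e / (k + 1))); rewrite divr_gt0// => /(_ isT).
apply: filterS => y; rewrite ltr_pdivlMr// => hy.
have TB : T x - T y = T (x - y).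
  by have := linT (-1) y x; rewrite !scaleN1r [x - y]addrC => ->; rewrite addrC.
rewrite TB; apply: le_lt_trans (hk _) _; apply: le_lt_trans hy.
by rewrite mulrC ler_wpM2l ?nm_ge0// lerDl.
Qed.

Section linear_rules.
Context T (linT : linear T).

Lemma lopD x y : T (x + y) = T x + T y.
Proof. by have := linT 1 x y; rewrite !scale1r. Qed.

Lemma lop0 : T 0 = 0.
Proof. by apply: (@addrI _ (T 0)); rewrite -lopD !addr0. Qed.

Lemma lopZ (c : R[i]) x : T (c *: x) = c *: T x.
Proof. by have := linT c x 0; rewrite lop0 !addr0. Qed.

Lemma lopN x : T (- x) = - T x.
Proof. by rewrite -scaleN1r lopZ scaleN1r. Qed.

Lemma lopB x y : T (x - y) = T x - T y.
Proof. by rewrite lopD lopN. Qed.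

End linear_rules.

Lemma bounded_op0 : bounded_op (0 : H -> H).
Proof.
apply/bounded_opP; split=> [c x y|]; first by rewrite scaler0 addr0.
by exists 0 => // x; rewrite mul0r nm0.
Qed.

Lemma bounded_op_id : bounded_op (idfun : H -> H).
Proof. by apply/bounded_opP; split=> //; exists 1 => // x; rewrite mul1r. Qed.

Lemma bounded_opD S T : bounded_op S -> bounded_op T -> bounded_op (S + T).
Proof.
move=> /bounded_opP[lS [k k0 hS]] /bounded_opP[lT [l l0 hT]]; apply/bounded_opP.
split=> [c x y|].
  by rewrite !opE lS lT scalerDr !addrA; congr (_ + _); rewrite addrAC.
exists (k + l) => [|x]; first exact: addr_ge0.
by rewrite mulrDl; exact: le_trans (nmD _ _) (lerD (hS _) (hT _)).
Qed.

Lemma bounded_opZ (c : R[i]) T : bounded_op T -> bounded_op (c *: T).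
Proof.
move=> /bounded_opP[lT [l l0 hT]]; apply/bounded_opP.
split=> [d x y|].
  by rewrite !opE lT scalerDr !scalerA mulrC.
have cc : `|c| = (complex.Re `|c|)%:C by rewrite RRe_real// normr_real.
have c0 : 0 <= complex.Re `|c| by rewrite -ler0c -cc.
exists (complex.Re `|c| * l) => [|x]; first exact: mulr_ge0.
rewrite -lecR -normE normrZ cc normE -rmorphM lecR -mulrA.
exact: ler_wpM2l.
Qed.

Lemma bounded_opN T : bounded_op T -> bounded_op (- T).
Proof. by move=> /(bounded_opZ (-1)); rewrite scaleN1r. Qed.

Lemma bounded_opB S T : bounded_op S -> bounded_op T -> bounded_op (S - T).
Proof. by move=> bS /bounded_opN; exact: bounded_opD. Qed.

Lemma bounded_op_comp S T : bounded_op S -> bounded_op T -> bounded_op (S \o T).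
Proof.
move=> [lS cS] [lT cT]; split=> [c x y|x]; first by rewrite /= lT lS.
exact: continuous_comp (cT x) (cS _).
Qed.

Lemma bounded_op_sum (J : Type) (r : seq J) (P : pred J) (U : J -> H -> H) :
  (forall j, P j -> bounded_op (U j)) -> bounded_op (\sum_(j <- r | P j) U j).
Proof.
move=> hU; apply: (big_ind (@bounded_op R H)) => //; first exact: bounded_op0.
exact: bounded_opD.
Qed.

Lemma opnorm_has_sup T : bounded_op T ->
  has_sup [set complex.Re `|T x| | x in [set x | `|x| <= 1]].
Proof.
move=> /bounded_opP[lT [l l0 hT]]; split.
  by exists (nm (T 0)), 0 => //=; rewrite normr0.
exists l => _ [x /= x1 <-]; apply: le_trans (hT x) _.
by rewrite ler_piMr// -lecR -normE.
Qed.

Lemma opnorm_ge0 T : bounded_op T -> 0 <= opnorm T.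
Proof.
move=> bT; have [_ ub] := opnorm_has_sup bT.
apply: le_trans (nm_ge0 (T 0)) _; apply: ub_le_sup => //.
by exists 0 => //=; rewrite normr0.
Qed.

Lemma opnormP T : bounded_op T -> forall x, nm (T x) <= opnorm T * nm x.
Proof.
move=> bT x; have [_ ub] := opnorm_has_sup bT.
have [x0|x0] := eqVneq (nm x) 0.
  by rewrite (nm_eq0 x0) (lop0 bT.1) nm0 mulr0.
have xp : 0 < nm x by rewrite lt_def x0 nm_ge0.
rewrite -ler_pdivrMr// mulrC -[_^-1]ger0_norm ?invr_ge0 ?nm_ge0//.
rewrite -nmZ -(lopZ bT.1); apply: ub_le_sup => //; exists ((nm x)^-1%:C *: x) => //=.
by rewrite normE nmZ ger0_norm ?invr_ge0 ?nm_ge0// mulVf.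
Qed.

Lemma opnorm_le T k : 0 <= k -> (forall x, nm (T x) <= k * nm x) ->
  opnorm T <= k.
Proof.
move=> k0 hT; apply: ge_sup.
  by exists (nm (T 0)), 0 => //=; rewrite normr0.
move=> _ [x /= x1 <-]; apply: le_trans (hT x) _.
by rewrite ler_piMr// -lecR -normE.
Qed.

Lemma opnormD_le S T V : bounded_op S -> bounded_op T ->
  (forall x, nm (V x) <= nm (S x) + nm (T x)) -> opnorm V <= opnorm S + opnorm T.
Proof.
move=> bS bT hV; apply: opnorm_le => [|x]; first by rewrite addr_ge0 ?opnorm_ge0.
by apply: le_trans (hV x) _; rewrite mulrDl lerD ?opnormP.
Qed.

Lemma opnorm_dist S T V : bounded_op S -> bounded_op T -> bounded_op V ->
  opnorm (S - V) <= opnorm (S - T) + opnorm (T - V).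
Proof.
move=> bS bT bV; apply: opnormD_le; [exact: bounded_opB..|move=> x].
apply: le_trans (nmD _ _); rewrite le_eqVlt; apply/orP; left; apply/eqP.
by rewrite !opE addrA subrK.
Qed.

Definition rsym T := forall x y, rdot (T x) y = rdot x (T y).

(** Real symmetry at [y] and at [i y] gives the real and the imaginary part of the complex identity,
    as [T] is complex linear. *)
Lemma selfadjointP T : selfadjoint T <-> bounded_op T /\ rsym T.
Proof.
split=> [[bT hT]|[bT hT]]; split=> // x y; first by rewrite /rdot hT.
rewrite !hdot_Re_Im hT; congr (_ +i* _).
by rewrite hT (lopZ bT.1).
Qed.

Lemma hdot_selfadjoint T x : selfadjoint T -> '[< T x, x >] = (rdot (T x) x)%:C.
Proof.
move=> /selfadjointP[[lT _] sT]; rewrite hdot_Re_Im; congr (_ +i* _).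
have : rdot (T x) ('i *: x) = - rdot (T x) ('i *: x).
  rewrite {1}sT (lopZ lT) rdotC.
  rewrite /rdot !linearZl_LR !linearZr_LR /=.
  by case: (hdot _ _ _) => p q /=; rewrite !mul0r !mul1r !mulN1r; ring.
by lra.
Qed.

(** The order of [R[i]] also demands equal imaginary parts; forms of selfadjoint operators have
    none. *)
Lemma op_leP S T : selfadjoint S -> selfadjoint T ->
  op_le S T <-> (forall x, rdot (S x) x <= rdot (T x) x).
Proof.
move=> sS sT; split=> h x; have := h x.
  by rewrite !hdot_selfadjoint// lecR.
by rewrite !hdot_selfadjoint// lecR.
Qed.

Lemma selfadjoint0 : selfadjoint (0 : H -> H).
Proof.
apply/selfadjointP; split; first exact: bounded_op0.
by move=> x y; rewrite rdot0l rdot0r.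
Qed.

Lemma selfadjoint_id : selfadjoint (idfun : H -> H).
Proof. by apply/selfadjointP; split=> //; exact: bounded_op_id. Qed.

Lemma selfadjointD S T : selfadjoint S -> selfadjoint T -> selfadjoint (S + T).
Proof.
move=> /selfadjointP[bS sS] /selfadjointP[bT sT]; apply/selfadjointP.
split; first exact: bounded_opD.
by move=> x y; rewrite opE rdotDl rdotDr sS sT.
Qed.

Lemma selfadjointZ a T : selfadjoint T -> selfadjoint (a%:C *: T).
Proof.
move=> /selfadjointP[bT sT]; apply/selfadjointP.
split; first exact: bounded_opZ.
by move=> x y; rewrite opE rdotZl rdotZr sT.
Qed.

Lemma selfadjointN T : selfadjoint T -> selfadjoint (- T).
Proof. by move=> /(selfadjointZ (-1)); rewrite rmorphN1 scaleN1r. Qed.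

Lemma selfadjointB S T : selfadjoint S -> selfadjoint T -> selfadjoint (S - T).
Proof. by move=> sS /selfadjointN; exact: selfadjointD. Qed.

(** The numerical radius bounds the norm. The forms at [x + s T x] and [x - s T x] differ by
    [4 s |T x|^2], and the parallelogram law bounds this difference by
    [2 k (|x|^2 + s^2 |T x|^2)]. *)
Lemma selfadjoint_form_bound T k : selfadjoint T -> 0 <= k ->
  (forall x, `|rdot (T x) x| <= k * nm x ^+ 2) -> forall x, nm (T x) <= k * nm x.
Proof.
move=> /selfadjointP[[lT _] sT] k0 hT x.
have par s : 4 * s * nm (T x) ^+ 2 <= 2 * k * (nm x ^+ 2 + s ^+ 2 * nm (T x) ^+ 2).
  have h1 := le_trans (ler_norm _) (hT (x + s%:C *: T x)).
  have h2 := hT (x - s%:C *: T x); rewrite ler_norml in h2.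
  have {h2} /andP[h2 _] := h2.
  move: h1 h2; rewrite nmD_sqr nmB_sqr nmZ exprMn real_normK ?num_real//.
  rewrite !(lopB lT) !(lopD lT) !(lopZ lT) !(rdotDl, rdotBl, rdotDr, rdotBr).
  rewrite !(rdotNl, rdotNr) !(rdotZl, rdotZr) -!rdotxx (sT (T x) x) (rdotC x (T x)).
  by lra.
have [kz|k1] := eqVneq k 0.
  have := par 1; rewrite kz mulr0 mul0r.
  have := sqr_ge0 (nm (T x)); rewrite mul0r => h1 h2.
  by rewrite -(@ler_pXn2r _ 2) ?nnegrE ?nm_ge0// expr0n /=; lra.
rewrite -(@ler_pXn2r _ 2) ?nnegrE ?mulr_ge0 ?nm_ge0//.
have kp : 0 < k by rewrite lt_def k1.
(* With [s = 1 / k] the term in [|T x|^2] on the right is half of the one on the left. *)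
have h := par k^-1; rewrite -subr_ge0 in h.
rewrite exprMn -subr_ge0.
have -> : k ^+ 2 * nm x ^+ 2 - nm (T x) ^+ 2 = k / 2 * (2 * k * (nm x ^+ 2 + k^-1 ^+ 2 * nm (T x) ^+ 2) -
       4 * k^-1 * nm (T x) ^+ 2) by field.
by apply: mulr_ge0 => //; rewrite divr_ge0.
Qed.

Lemma selfadjoint_opnorm_limit (U : nat -> H -> H) V : bounded_op V ->
  (forall n, selfadjoint (U n)) -> opnorm (V - U n) @[n --> \oo] --> (0 : R) ->
  selfadjoint V.
Proof.
move=> bV sU cU; apply/selfadjointP; split=> // x y; apply/eqP.
rewrite -subr_eq0 -normr_le0; apply/ler_addgt0Pl => e e0.
rewrite addr0.
pose c := 2 * nm x * nm y + 1.
have c0 : 0 < c by rewrite ltr_wpDl// !mulr_ge0 ?nm_ge0.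
move/cvgrPdist_lt: cU => /(_ (e / c)); rewrite divr_gt0// => /(_ isT)[N _ hN].
have {hN} := hN N (leqnn N); rewrite /= sub0r normrN.
have /selfadjointP[bN sN] := sU N.
have bVN := bounded_opB bV bN.
rewrite ger0_norm ?opnorm_ge0// ltr_pdivlMr// => he; apply: ltW; apply: le_lt_trans he.
have -> : rdot (V x) y - rdot x (V y) =
    rdot ((V - U N) x) y - rdot x ((V - U N) y).
  by rewrite !opE rdotBl rdotBr sN; ring.
apply: le_trans (ler_normB _ _) _.
have h1 := rdot_abs_le ((V - U N) x) y.
have h2 := rdot_abs_le x ((V - U N) y).
have h3 := opnormP bVN x; have h4 := opnormP bVN y.
have := nm_ge0 x; have := nm_ge0 y; have := opnorm_ge0 bVN.
move: h1 h2 h3 h4; rewrite /c; set o := opnorm _.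
move=> h1 h2 h3 h4 o0 y0 x0.
apply: (@le_trans _ _ (o * nm x * nm y + nm x * (o * nm y))); last by lra.
apply: lerD; first exact: le_trans h1 (ler_wpM2r y0 h3).
exact: le_trans h2 (ler_wpM2l x0 h4).
Qed.

End Operators.

(** * Spectra of selfadjoint operators *)

Section Spectrum.
Context {R : realType} {H : hilbertType R}.
Implicit Types (x y z : H) (a k c m t : R) (S T P A B V : H -> H).

(** Banach's fixed point theorem, by iteration from [0]. *)
Lemma contraction_fixed_point (g : H -> H) (r : R) : 0 <= r -> r < 1 ->
  (forall x y, nm (g x - g y) <= r * nm (x - y)) -> exists z, g z = z.
Proof.
move=> r0 r1 hg; pose u n := iter n g 0.
have step n : nm (u n - u n.+1) <= r ^+ n * nm (g 0).
  elim: n => [|n IH]; first by rewrite expr0 mul1r /u /= sub0r nmN.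
  by apply: le_trans (hg _ _) _; rewrite exprS -mulrA ler_wpM2l.
have r1' : 0 < 1 - r by rewrite subr_gt0.
pose C := nm (g 0) / (1 - r).
have C0 : 0 <= C by rewrite divr_ge0 ?nm_ge0 ?ltW.
(* The geometric tail is kept as a difference, so that each step of the induction on [d] telescopes:
   [|g 0| = C (1 - r)]. *)
have far n d : nm (u n - u (n + d)%N) <= r ^+ n * C - r ^+ (n + d) * C.
  elim: d => [|d IH]; first by rewrite addn0 !subrr nm0.
  rewrite -[u n](subrK (u (n + d)%N)) -addrA.
  apply: le_trans (nmD _ _) _; rewrite addnS.
  apply: le_trans (lerD IH (step _)) _.
  have -> : nm (g 0) = C * (1 - r) by rewrite divfK ?gt_eqF.
  by rewrite exprS; lra.
have geo e : 0 < e -> \forall n \near \oo, r ^+ n * C < e.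
  move=> e0; have : r ^+ n * C @[n --> \oo] --> 0 * C.
    by apply: cvgMl; apply: cvg_expr; rewrite ger0_norm.
  rewrite mul0r => /cvgrPdist_lt/(_ _ e0); apply: filterS => n.
  by rewrite sub0r normrN ger0_norm // mulr_ge0 ?exprn_ge0.
have cu : cvgn u.
  apply: nm_cauchy_cvg => e e0; apply: filterS (geo e e0) => n hn p np.
  rewrite -(subnKC np); apply: le_lt_trans (far _ _) _; apply: le_lt_trans hn.
  by rewrite gerBl mulr_ge0 ?exprn_ge0.
have /cvg_ex[z /cvg_nm cz] := cu.
exists z; apply/eqP; rewrite -subr_eq0; apply/eqP/nm_eq0/eqP.
rewrite eq_le nm_ge0 andbT; apply/ler_addgt0Pl => e e0; rewrite addr0.
have e2 : 0 < e / 2 by rewrite divr_gt0.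
have [N1 _ h1] := cz _ e2.
have h2 := h1 N1 (leqnn N1); have h3 := h1 N1.+1 (leqnSn N1).
rewrite -[g z](subrK (u N1.+1)) -addrA.
apply: le_trans (nmD _ _) _; rewrite [e]splitr; apply: lerD.
  apply: le_trans (hg _ _) _; apply: le_trans (ltW h2).
  by rewrite ler_piMl ?nm_ge0// ltW.
by rewrite nm_sub ltW.
Qed.

(* For tau = c / M^2 the map x |-> x - tau (P x - y) is a contraction whose fixed point
   solves P x = y. *)
Lemma coercive_inverse P c : selfadjoint P -> 0 < c ->
  (forall x, c * nm x ^+ 2 <= rdot (P x) x) ->
  exists S, [/\ bounded_op S, P \o S = idfun & S \o P = idfun].
Proof.
move=> /selfadjointP[bP sP] c0 hP.
have [lP [k k0 hk]] := (bounded_opP P).1 bP.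
(* [M] dominates a bound of [P] and also [c]; the latter makes [q] below nonnegative. *)
pose M := k + c.
have M0 : 0 < M by rewrite /M; lra.
have hM x : nm (P x) <= M * nm x.
  by apply: le_trans (hk x) _; rewrite ler_wpM2r ?nm_ge0// /M lerDl ltW.
pose tau := c / M ^+ 2.
have tau0 : 0 < tau by rewrite divr_gt0 ?exprn_gt0.
have inj x : c * nm x <= nm (P x).
  have [->|x0] := eqVneq (nm x) 0; first by rewrite mulr0 nm_ge0.
  have xp : 0 < nm x by rewrite lt_def x0 nm_ge0.
  rewrite -(ler_pM2r xp) -mulrA -expr2.
  exact: le_trans (hP x) (rdot_le _ _).
have [r [r0 r1 hr]] : exists r, [/\ 0 <= r, r < 1 &
    forall x, nm (x - tau%:C *: P x) <= r * nm x].
  have cM : c <= M by rewrite /M; lra.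
  (* [|x - tau P x|^2 <= (1 - 2 tau c + tau^2 M^2) |x|^2], and [tau M^2 = c] collapses the factor to
     [q]. *)
  pose q := 1 - tau * c.
  have q0 : 0 <= q.
    rewrite /q /tau subr_ge0 mulrAC -expr2 ler_pdivrMr ?exprn_gt0// mul1r.
    by rewrite lerXn2r ?nnegrE ?(ltW c0) ?(ltW M0).
  have q1 : q < 1 by rewrite /q; have := mulr_gt0 tau0 c0; lra.
  exists (Num.sqrt q); split => [||x].
  - exact: sqrtr_ge0.
  - by rewrite -[X in _ < X]sqrtr1 ltr_sqrt.
  rewrite -(@ler_pXn2r _ 2) ?nnegrE ?mulr_ge0 ?sqrtr_ge0 ?nm_ge0//.
  rewrite exprMn sqr_sqrtr// nmB_sqr rdotZr nmZ exprMn real_normK ?num_real//.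
  rewrite (rdotC x).
  have h1 := hP x.
  have h2 : nm (P x) ^+ 2 <= M ^+ 2 * nm x ^+ 2.
    by rewrite -exprMn ler_pXn2r ?nnegrE ?mulr_ge0 ?nm_ge0// ltW.
  have h3 : tau ^+ 2 * nm (P x) ^+ 2 <= tau * (c * nm x ^+ 2).
    rewrite expr2 -mulrA ler_pM2l//.
    apply: le_trans (ler_wpM2l (ltW tau0) h2) _.
    by rewrite mulrA /tau divfK// gt_eqF// exprn_gt0.
  have h4 := ler_wpM2l (ltW tau0) h1.
  by rewrite /q; lra.
have surj y : exists x, P x = y.
  pose g x := x - tau%:C *: (P x - y).
  have [x1 x2|z hz] := @contraction_fixed_point g r r0 r1.
    have -> : g x1 - g x2 = (x1 - x2) - tau%:C *: P (x1 - x2).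
      rewrite /g (lopB lP) opprD opprK addrACA; congr (_ + _).
      rewrite addrC -scalerBr -scalerN opprB; congr (_ *: _).
      by rewrite opprB addrA subrK.
    exact: hr.
  exists z; apply/eqP; rewrite -subr_eq0.
  have : tau%:C *: (P z - y) = 0.
    by apply: oppr_inj; apply: (@addrI _ z); rewrite oppr0 addr0 -[LHS]/(g z).
  by move/eqP; rewrite scaler_eq0 => /orP[/eqP[] h|//]; rewrite h ltxx in tau0.
pose S y := xget 0 [set x | P x = y].
have PS y : P (S y) = y.
  by rewrite /S; case: xgetP => [x _ //|h]; have [x hx] := surj y; case: (h x).
have Pinj x y : P x = P y -> x = y.
  move=> hxy; apply/eqP; rewrite -subr_eq0; apply/eqP/nm_eq0.
  have := inj (x - y); rewrite (lopB lP) hxy subrr nm0 pmulr_rle0//.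
  by have := nm_ge0 (x - y); lra.
exists S; split.
- apply/bounded_opP; split=> [a x y|].
    by apply: Pinj; rewrite lP !PS.
  exists c^-1 => [|y]; first by rewrite invr_ge0 ltW.
  rewrite mulrC ler_pdivlMr// mulrC.
  by apply: le_trans (inj _) _; rewrite PS.
- by apply/funext => y /=; rewrite PS.
- by apply/funext => y /=; apply: Pinj; rewrite PS.
Qed.

(** A coercive [T - a] or [a - T] has a bounded inverse. This confines the spectrum between any
    bounds of the form. *)
Lemma spectrum_coercive T a c : selfadjoint T -> 0 < c ->
  (forall x, c * nm x ^+ 2 <= rdot (T x) x - a * nm x ^+ 2) \/
  (forall x, c * nm x ^+ 2 <= a * nm x ^+ 2 - rdot (T x) x) ->
  ~ spectrum T a%:C.
Proof.
move=> sT c0 h; apply; have sTa := selfadjointB sT (selfadjointZ a (@selfadjoint_id _ H)).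
case: h => h.
  apply: (coercive_inverse sTa c0) => x.
  by rewrite !opE rdotBl rdotZl rdotxx.
have [x|S [bS h1 h2]] := coercive_inverse (selfadjointN sTa) c0.
  by rewrite !opE rdotNl rdotBl rdotZl rdotxx opprB.
have lT := (selfadjointP _).1 sTa.
exists (- S); split; first exact: bounded_opN.
  apply/funext => x /=; rewrite -[RHS](congr1 (@^~ x) h1) /=.
  by rewrite oppopE (lopN lT.1.1).
by apply/funext => x /=; rewrite -[RHS](congr1 (@^~ x) h2) /= !oppopE (lopN bS.1).
Qed.

(* For b != 0 the inverse of T - (a + ib) is obtained from that of the coercive operator
   (T - a)^2 + b^2 = (T - (a + ib)) (T - (a - ib)). *)
Lemma spectrum_real T (w : R[i]) : selfadjoint T -> spectrum T w ->
  w = (complex.Re w)%:C.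
Proof.
case: w => a b sT hw; have [-> //|b0] := eqVneq b 0; exfalso; apply: hw.
have [bT sT'] := (selfadjointP _).1 sT.
pose U := T - a%:C *: idfun.
have sU : selfadjoint U by apply: selfadjointB => //; exact/selfadjointZ/selfadjoint_id.
have [bU symU] := (selfadjointP _).1 sU.
have lU := bU.1.
pose P := U \o U + (b ^+ 2)%:C *: idfun.
have bP : bounded_op P.
  by apply: bounded_opD; [exact: bounded_op_comp|exact/bounded_opZ/bounded_op_id].
have sP : selfadjoint P.
  apply/selfadjointP; split=> // x y.
  by rewrite /P !opE /= rdotDl rdotDr !symU rdotZl rdotZr.
have b2 : 0 < b ^+ 2 by rewrite exprn_even_gt0.
have [x|S [bS PS SP]] := coercive_inverse sP b2.
  by rewrite /P !opE /= rdotDl rdotZl symU !rdotxx lerDr sqr_ge0.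
pose Z := T - (a +i* b) *: idfun; pose Z' := T - (a -i* b) *: idfun.
have UE x : U x = T x - a%:C *: x by [].
have ZE x : Z x = U x - (b *i) *: x.
  by rewrite UE /Z !opE -addrA -opprD -scalerDl; congr (_ - _ *: _); rewrite /=; apply/eqP; rewrite eq_complex /= addr0 add0r !eqxx.
have Z'E x : Z' x = U x + (b *i) *: x.
  rewrite UE /Z' !opE -addrA; congr (_ + _); rewrite -!scaleNr -scalerDl.
  by congr (_ *: _); apply/eqP; rewrite eq_complex /= addr0 oppr0 add0r opprK !eqxx.
have bb : (b *i) * (b *i) = - (b ^+ 2)%:C :> R[i].
  by apply/eqP; rewrite eq_complex /= !(mul0r, mulr0, add0r, oppr0) -expr2 !eqxx.
have ZZ' x : Z (Z' x) = P x.
  rewrite ZE Z'E (lopD lU) (lopZ lU).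
  rewrite (scalerDr _ (U x) (_ *: x)) addrKA.
  by rewrite scalerA bb scaleNr opprK.
have Z'Z x : Z' (Z x) = P x.
  rewrite Z'E ZE (lopB lU) (lopZ lU) (scalerBr _ (U x) (_ *: x)) addrA subrK.
  by rewrite scalerA bb scaleNr opprK.
have PS' x : P (S x) = x := congr1 (@^~ x) PS.
have SP' x : S (P x) = x := congr1 (@^~ x) SP.
have bZ' : bounded_op Z' by apply: bounded_opB => //; exact/bounded_opZ/bounded_op_id.
have hl x : Z (Z' (S x)) = x by rewrite ZZ'.
have hr x : S (Z' (Z x)) = x by rewrite Z'Z.
exists (Z' \o S); split; first exact: bounded_op_comp.
  by apply/funext => x /=; exact: hl.
(* [Z] has the right inverse [Z' \o S] and the left inverse [S \o Z'], so the two agree and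
   commuting [S] with [Z'] is avoided. *)
apply/funext => x /=; rewrite -/(Z x).
by rewrite -[LHS]hr hl hr.
Qed.

(* Positivity of P at the vector x - k^-1 P x. *)
Lemma psd_nm_le P k : selfadjoint P -> 0 < k -> (forall x, nm (P x) <= k * nm x) ->
  (forall x, 0 <= rdot (P x) x) ->
  forall x, nm (P x) ^+ 2 <= k * rdot (P x) x.
Proof.
move=> /selfadjointP[[lP _] sP] k0 hk pP x.
have := pP (x - k^-1%:C *: P x).
rewrite (lopB lP) (lopZ lP) rdotBl !rdotBr !(rdotZl, rdotZr).
rewrite (sP (P x) x) (rdotxx (P x)).
have h : rdot (P (P x)) (P x) <= k * nm (P x) ^+ 2.
  apply: le_trans (rdot_le _ _) _; rewrite expr2 mulrA.
  by rewrite ler_wpM2r ?nm_ge0.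
have ki : 0 < k^-1 by rewrite invr_gt0.
have h' := ler_wpM2l (ltW ki) h; rewrite mulrA mulVf ?gt_eqF// mul1r in h'.
have h2 := ler_wpM2l (ltW ki) h'.
move=> h3; rewrite -subr_ge0.
have {}h3 : 0 <= rdot (P x) x - k^-1 * nm (P x) ^+ 2 by lra.
have := mulr_ge0 (ltW k0) h3; rewrite mulrBr mulrA mulfV ?gt_eqF// mul1r.
by [].
Qed.

Definition form_lower T m := forall x, m * nm x ^+ 2 <= rdot (T x) x.

Definition form_upper T m := forall x, rdot (T x) x <= m * nm x ^+ 2.

(* The best lower bound m is in the spectrum: if T - m had a bounded inverse, psd_nm_le
   would make T - m coercive. *)
Lemma form_lower_spectrum T (x1 : H) : x1 != 0 -> selfadjoint T ->
  exists2 m, form_lower T m & spectrum T m%:C.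
Proof.
move=> x10 sT; have [bT sT'] := (selfadjointP _).1 sT.
have [lT [k k0 hk]] := (bounded_opP T).1 bT.
pose E := [set a | form_lower T a].
have x1p : 0 < nm x1 ^+ 2.
  by rewrite exprn_even_gt0//=; apply: contra_neq x10; exact: nm_eq0.
have Ek : E (- k).
  move=> x; have := rdot_abs_le (T x) x; rewrite ler_norml => /andP[h _].
  by apply: le_trans h; rewrite mulNr lerN2 expr2 mulrA ler_wpM2r ?nm_ge0.
have ubE : ubound E (rdot (T x1) x1 / nm x1 ^+ 2).
  by move=> a /(_ x1); rewrite ler_pdivlMr.
have supE : has_sup E by split; [exists (- k)|exists (rdot (T x1) x1 / nm x1 ^+ 2)].
pose m := sup E.
have lm : form_lower T m.
  move=> x; have [x0|x0] := eqVneq (nm x) 0.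
    by rewrite x0 expr0n mulr0 (nm_eq0 x0) rdot0r.
  have xp : 0 < nm x ^+ 2 by rewrite exprn_even_gt0.
  rewrite -ler_pdivlMr//; apply: ge_sup; first by exists (- k).
  by move=> a /(_ x); rewrite ler_pdivlMr.
exists m => //; rewrite /spectrum /= => -[S [bS hl hr]].
have [lS [l l0 hS]] := (bounded_opP S).1 bS.
pose P := T - m%:C *: idfun.
have sP : selfadjoint P by apply: selfadjointB => //; exact/selfadjointZ/selfadjoint_id.
have [bP _] := (selfadjointP _).1 sP.
have [lP [k' k'0 hk']] := (bounded_opP P).1 bP.
have kk : 0 < k' + 1 by lra.
have PE x : rdot (P x) x = rdot (T x) x - m * nm x ^+ 2.
  by rewrite /P !opE rdotBl rdotZl rdotxx.
have h x : nm (P x) ^+ 2 <= (k' + 1) * rdot (P x) x.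
  apply: psd_nm_le => // {}x; last by rewrite PE subr_ge0.
  by apply: le_trans (hk' x) _; rewrite ler_wpM2r ?nm_ge0// lerDl.
(* Chaining [|x| <= (l + 1) |P x|] with [|P x|^2 <= (k' + 1) <P x, x>] gives this coercivity
   constant; the added units keep it positive. Then [m + c] is a lower bound beyond the supremum
   [m]. *)
pose c := ((l + 1) ^+ 2 * (k' + 1))^-1.
have l1 : 0 < l + 1 by lra.
have c0 : 0 < c by rewrite invr_gt0 mulr_gt0 ?exprn_gt0.
have Emc : E (m + c).
  move=> x; rewrite mulrDl -lerBrDl -PE /c mulrC ler_pdivrMr ?mulr_gt0 ?exprn_gt0//.
  have Sx : nm x <= (l + 1) * nm (P x).
    have := hS (P x); have -> : S (P x) = x := congr1 (@^~ x) hr.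
    by move/le_trans; apply; rewrite ler_wpM2r ?nm_ge0// lerDl.
  have := Sx; rewrite -(@ler_pXn2r _ 2) ?nnegrE ?mulr_ge0 ?nm_ge0 ?(ltW l1)//.
  move/le_trans; apply; rewrite exprMn (mulrC (rdot _ _)) -[leRHS]mulrA ler_wpM2l ?sqr_ge0//.
have := ub_le_sup (proj2 supE) Emc; rewrite -/m.
by lra.
Qed.

Lemma spectrumN T (w : R[i]) : bounded_op T -> spectrum (- T) (- w) -> spectrum T w.
Proof.
move=> bT hN [S [bS hl hr]]; apply: hN; exists (- S).
have E x : (- T - (- w) *: idfun) x = - (T - w *: idfun) x.
  by rewrite !opE scaleNr opprK opprB addrC.
have lTw : linear (T - w *: idfun).
  by have [] := bounded_opB bT (bounded_opZ w (@bounded_op_id _ H)).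
split; first exact: bounded_opN.
  apply/funext => x /=; rewrite E oppopE (lopN lTw) opprK.
  exact: (congr1 (@^~ x) hl).
apply/funext => x /=; rewrite E oppopE (lopN bS.1) opprK.
exact: (congr1 (@^~ x) hr).
Qed.

Lemma form_upper_spectrum T (x1 : H) : x1 != 0 -> selfadjoint T ->
  exists2 m, form_upper T m & spectrum T m%:C.
Proof.
move=> x10 sT; have [m lm sm] := form_lower_spectrum x10 (selfadjointN sT).
exists (- m) => [x|]; first by have := lm x; rewrite opE rdotNl mulNr lerNr.
by apply: spectrumN => [|]; [case: sT|rewrite rmorphN opprK].
Qed.

(** The form of the combination lies between the smaller lower bound and the larger upper bound of
    the forms of [A] and [B]. These bounds can be taken in the spectra, hence in [I], and the
    interval [I] contains what lies between. *)
Lemma SA_convex (I : interval R) A B t : SA I A -> SA I B -> t \in `[0%R, 1%R] ->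
  SA I ((1 - t)%:C *: A + t%:C *: B).
Proof.
move=> [sA iA] [sB iB]; rewrite in_itv /= => /andP[t0 t1].
have t1' : 0 <= 1 - t by lra.
set T := _ + _; have sT : selfadjoint T by apply: selfadjointD; exact: selfadjointZ.
split=> // w hw; have wE := spectrum_real sT hw.
have TE x : rdot (T x) x = (1 - t) * rdot (A x) x + t * rdot (B x) x.
  by rewrite /T !opE rdotDl !rdotZl.
have [[x1 x10]|triv] := pselect (exists x : H, x != 0); last first.
  (* On the zero space [0] inverts every operator, so the spectrum is empty and the inclusion is
     vacuous. *)
  have tr (x : H) : x = 0 by apply: contrapT => /eqP h; apply: triv; exists x.
  exfalso; apply: hw; exists 0; split; first exact: bounded_op0.
    by apply/funext => x; rewrite [LHS]tr [RHS]tr.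
  by apply/funext => x; rewrite [LHS]tr [RHS]tr.
rewrite wE in hw *; exists (complex.Re w) => //=; set r := complex.Re w in hw *.
have inI m : (exists T', [/\ spectrum T' m%:C & spectrum T' `<=` [set t%:C | t in [set` I]]]) ->
    m \in I.
  by move=> [T' [sm iT]]; have [u Iu /complexI <-] := iT _ sm.
have [a la sa] := form_lower_spectrum x10 sA.
have [b lb sb] := form_lower_spectrum x10 sB.
have [a' ua sa'] := form_upper_spectrum x10 sA.
have [b' ub sb'] := form_upper_spectrum x10 sB.
have Im : Num.min a b \in I by rewrite /Num.min; case: ifP => _; apply: inI; [exists A|exists B].
have IM : Num.max a' b' \in I by rewrite /Num.max; case: ifP => _; apply: inI; [exists B|exists A].
have lT : form_lower T (Num.min a b).
  move=> x; rewrite TE; have := la x; have := lb x.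
  have hh : Num.min a b * nm x ^+ 2 <= a * nm x ^+ 2 by rewrite ler_wpM2r ?sqr_ge0// ge_min lexx.
  have hh' : Num.min a b * nm x ^+ 2 <= b * nm x ^+ 2 by rewrite ler_wpM2r ?sqr_ge0// ge_min lexx orbT.
  move=> /(le_trans hh')/(ler_wpM2l t0) h1 /(le_trans hh)/(ler_wpM2l t1') h2.
  by apply: le_trans (lerD h2 h1); rewrite -mulrDl subrK mul1r.
have uT : form_upper T (Num.max a' b').
  move=> x; rewrite TE; have := ua x; have := ub x.
  have hh : a' * nm x ^+ 2 <= Num.max a' b' * nm x ^+ 2 by rewrite ler_wpM2r ?sqr_ge0// le_max lexx.
  have hh' : b' * nm x ^+ 2 <= Num.max a' b' * nm x ^+ 2 by rewrite ler_wpM2r ?sqr_ge0// le_max lexx orbT.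
  move=> /le_trans/(_ hh')/(ler_wpM2l t0) h1 /le_trans/(_ hh)/(ler_wpM2l t1') h2.
  by apply: le_trans (lerD h2 h1) _; rewrite -mulrDl subrK mul1r.
have rm : Num.min a b <= r.
  rewrite leNgt; apply/negP => rlt.
  apply: (@spectrum_coercive T r (Num.min a b - r)) hw => //; first by rewrite subr_gt0.
  by left => x; rewrite mulrBl lerD2r.
have rM : r <= Num.max a' b'.
  rewrite leNgt; apply/negP => rlt.
  apply: (@spectrum_coercive T r (r - Num.max a' b')) hw => //; first by rewrite subr_gt0.
  by right => x; rewrite mulrBl lerD2l lerN2.
by apply: (@interval_is_interval _ I _ _ Im IM r); rewrite rm rM.
Qed.

End Spectrum.

(** * The convex function attached to a segment *)

Section Calculus.
Context {R : realType} {H : hilbertType R}.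
Implicit Types (x y : H) (T : H -> H).

Lemma selfadjoint_sum (J : Type) (r : seq J) (P : pred J) (U : J -> H -> H) :
  (forall j, P j -> selfadjoint (U j)) -> selfadjoint (\sum_(j <- r | P j) U j).
Proof.
move=> hU; apply: (big_ind (@selfadjoint R H)) => //; first exact: selfadjoint0.
exact: selfadjointD.
Qed.

Lemma selfadjoint_iter T i : selfadjoint T -> selfadjoint (iter i T).
Proof.
move=> /selfadjointP[bT sT]; elim: i => [|i /selfadjointP[bi si]].
  exact: selfadjoint_id.
apply/selfadjointP; split; first exact: bounded_op_comp bT bi.
by move=> x y; rewrite /= sT si -iterSr.
Qed.

Lemma selfadjoint_poly_op q T : selfadjoint T -> selfadjoint (poly_op q T).
Proof.
by move=> sT; apply: selfadjoint_sum => i _; exact/selfadjointZ/selfadjoint_iter.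
Qed.

(** A norm limit of real polynomials in [T]; the default value [0] of [cfc] is selfadjoint too. *)
Lemma selfadjoint_cfc f T : selfadjoint T -> selfadjoint (cfc f T).
Proof.
move=> sT; rewrite /cfc; case: xgetP => [V _ [bV [q [_ cq]]]|_].
  apply: (selfadjoint_opnorm_limit bV _ cq) => n.
  exact: selfadjoint_poly_op.
exact: selfadjoint0.
Qed.

End Calculus.

(** * Differentiable convex functions on the closed unit interval *)

Section ConvexReal.
Context {R : realType}.
Implicit Types (g d : R -> R) (s t l e : R).

(** Differentiability relative to [[0, 1]], hence one-sided at the ends; written without a quotient,
    it makes no exception for [s = t]. *)
Definition unit_slope g t l := forall e : R, 0 < e -> exists2 r : R, 0 < r &
  forall s : R, s \in `[0, 1] -> `|s - t| < r -> `|g s - g t - l * (s - t)| <= e * `|s - t|.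

Definition unit_convex g := forall s t l, s \in `[0, 1] -> t \in `[0, 1] ->
  l \in `[0, 1] -> g ((1 - l) * s + l * t) <= (1 - l) * g s + l * g t.

Lemma unit_slope_unique g t l l' : t \in `[0, 1] ->
  unit_slope g t l -> unit_slope g t l' -> l = l'.
Proof.
rewrite in_itv /= => /andP[t0 t1] h h'; apply/eqP; rewrite -subr_eq0 -normr_le0.
apply/ler_addgt0Pl => e e0; rewrite addr0.
have e2 : 0 < e / 2 by rewrite divr_gt0.
have [r r0 hr] := h _ e2; have [r' r'0 hr'] := h' _ e2.
have [s [s1 st sr]] : exists s, [/\ s \in `[0%R, 1%R], s != t & `|s - t| < Num.min r r'].
  (* A displacement of at most [1 / 4], taken to the right for [t <= 1 / 2] and to the left
     otherwise, stays in [[0, 1]]. *)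
  pose m := Num.min (Num.min r r') 1 / 4.
  have mm : Num.min (Num.min r r') 1 = 4 * m by rewrite /m; field.
  have m1 : 4 * m <= 1 by rewrite -mm ge_min lexx orbT.
  have m2 : 4 * m <= Num.min r r' by rewrite -mm ge_min lexx.
  have m0 : 0 < m by rewrite divr_gt0// !lt_min r0 r'0 ltr01.
  have [th|th] := lerP t 2^-1.
    exists (t + m); rewrite in_itv /=; split; first by apply/andP; split; lra.
      by rewrite gt_eqF// ltrDl.
    by rewrite addrAC subrr add0r gtr0_norm//; lra.
  exists (t - m); rewrite in_itv /=; split; first by apply/andP; split; lra.
    by rewrite lt_eqF// gtrBl.
  by rewrite addrAC subrr add0r normrN gtr0_norm//; lra.
move: sr; rewrite lt_min => /andP[sr sr'].
have := hr s s1 sr; have := hr' s s1 sr' => a b.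
have st0 : 0 < `|s - t| by rewrite normr_gt0 subr_eq0.
rewrite -(ler_pM2r st0) -normrM.
have -> : (l - l') * (s - t) = (g s - g t - l' * (s - t)) - (g s - g t - l * (s - t)) by ring.
by apply: le_trans (ler_normB _ _) _; rewrite [e]splitr mulrDl lerD.
Qed.

(** At [(1 - q) t + q s] with [q] small, convexity bounds [g] from above and the slope bounds it
    from below. Both bounds are affine in [q], up to [q e]; dividing by [q] leaves the arbitrary
    error [e]. *)
Lemma convex_tangent g s t l : unit_convex g -> unit_slope g t l ->
  s \in `[0, 1] -> t \in `[0, 1] -> g t + l * (s - t) <= g s.
Proof.
move=> cg hg s1 t1; have [->|st] := eqVneq s t; first by rewrite subrr mulr0 addr0.
have st0 : 0 < `|s - t| by rewrite normr_gt0 subr_eq0.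
rewrite -subr_ge0 -oppr_le0; apply/ler_addgt0Pl => e e0; rewrite addr0.
have e2 : 0 < e / `|s - t| by rewrite divr_gt0.
have [r r0 hr] := hg _ e2.
pose q := Num.min (r / (2 * `|s - t|)) 1.
have q0 : 0 < q by rewrite lt_min divr_gt0 ?mulr_gt0// ltr01.
have q1 : q <= 1 by rewrite ge_min lexx orbT.
have qr : q * `|s - t| < r.
  have : q <= r / (2 * `|s - t|) by rewrite ge_min lexx.
  rewrite ler_pdivlMr ?mulr_gt0//; move: (mulr_gt0 q0 st0); rewrite mulrCA.
  by set w := q * _; move=> ? ?; lra.
have qI : q \in `[0%R, 1%R] by rewrite in_itv /= ltW.
have := cg _ _ _ t1 s1 qI.
have zI : (1 - q) * t + q * s \in `[0%R, 1%R].
  move: s1 t1; rewrite !in_itv /= => /andP[s0 s1] /andP[t0 t1].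
  by apply/andP; split; nra.
have zt : (1 - q) * t + q * s - t = q * (s - t) by ring.
have := hr _ zI; rewrite zt normrM (gtr0_norm q0) => /(_ qr).
have -> : e / `|s - t| * (q * `|s - t|) = q * e.
  by field; rewrite gt_eqF.
rewrite ler_norml => /andP[h _] hc.
rewrite -(ler_pM2l q0); lra.
Qed.

Section slopes.
Context g d (cg : unit_convex g)
  (hg : forall t, t \in `[0, 1] -> unit_slope g t (d t)).

(** The tangents at [s] and [t], each evaluated at the other point, add up to
    [0 <= (d t - d s) (t - s)]. *)
Lemma convex_slope_nondecreasing s t : s \in `[0, 1] -> t \in `[0, 1] ->
  s <= t -> d s <= d t.
Proof.
move=> s1 t1; rewrite le_eqVlt => /predU1P[->//|st].
have h1 := convex_tangent cg (hg s1) t1 s1.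
have h2 := convex_tangent cg (hg t1) s1 t1.
have st0 : 0 < t - s by rewrite subr_gt0.
by rewrite -(ler_pM2r st0); lra.
Qed.

Lemma convex_increment s t : s \in `[0, 1] -> t \in `[0, 1] -> s <= t ->
  d 0 * (t - s) <= g t - g s <= d 1 * (t - s).
Proof.
move=> s1 t1 st.
have I0 : 0 \in `[0%R, 1%R :> R] by rewrite in_itv /= lexx ler01.
have I1 : 1 \in `[0%R, 1%R :> R] by rewrite in_itv /= lexx ler01.
have h1 := convex_tangent cg (hg s1) t1 s1.
have h2 := convex_tangent cg (hg t1) s1 t1.
have [s0 t1'] : 0 <= s /\ t <= 1.
  by move: s1 t1; rewrite !in_itv /= => /andP[? ?] /andP[? ?].
have h3 := convex_slope_nondecreasing I0 s1 s0.
have h4 := convex_slope_nondecreasing t1 I1 t1'.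
have st0 : 0 <= t - s by rewrite subr_ge0.
have := ler_wpM2r st0 h3; have := ler_wpM2r st0 h4.
by move=> ? ?; apply/andP; split; lra.
Qed.

End slopes.

End ConvexReal.

(** * The function of operators along a segment and its Gateaux derivative *)

Section Path.
Context {R : realType} {H : hilbertType R} (I : interval R) (f : R -> R)
  (A B : H -> H).
Hypotheses (f_convex : operator_convex I f) (SA_A : SA I A) (SA_B : SA I B).
Hypothesis f_diff : gateaux_on I (cfc f) (segment A B).
Implicit Types (x y : H) (s t : R).

(** The segment run from [A] to [B], so that [B - A] is its velocity; the integrand of the theorem
    is [f] of this path at [1 - t]. *)
Definition opath t : H -> H := (1 - t)%:C *: A + t%:C *: B.

Definition fpath t : H -> H := cfc f (opath t).

Definition npath t : H -> H := nabla I (cfc f) (opath t) (B - A).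

Let SA_path t : t \in `[0, 1] -> SA I (opath t).
Proof. exact: SA_convex. Qed.

Lemma selfadjoint_fpath t : selfadjoint (fpath t).
Proof.
by apply: selfadjoint_cfc; apply: selfadjointD; apply: selfadjointZ;
  [case: SA_A|case: SA_B].
Qed.

Let path_affine s t (l : R) :
  (1 - l)%:C *: opath s + l%:C *: opath t = opath ((1 - l) * s + l * t).
Proof.
apply/funext => x; rewrite /opath !opE !scalerDr !scalerA addrACA -!scalerDl.
by rewrite -!rmorphM -!rmorphD /=; congr (_%:C *: _ + _%:C *: _); ring.
Qed.

Let path_step s t : opath t + s%:C *: (B - A) = opath (t + s).
Proof.
apply/funext => x; rewrite /opath !opE scalerBr [s%:C *: B x - _]addrC.
rewrite addrACA -scalerBl -scalerDl -rmorphB -rmorphD /=.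
by congr (_%:C *: _ + _); ring.
Qed.

Lemma fpath_convex x : unit_convex (fun t => rdot (fpath t x) x).
Proof.
move=> s t l s1 t1 l1 /=.
have [_ cf] := f_convex; have := cf H _ _ l (SA_path s1) (SA_path t1) l1.
rewrite path_affine -!/(fpath _) => h.
have := (op_leP _ _).1 h x; rewrite !opE rdotDl !rdotZl; apply.
  exact: selfadjoint_fpath.
by apply: selfadjointD; apply: selfadjointZ; exact: selfadjoint_fpath.
Qed.

Lemma gateaux_npath t : t \in `[0, 1] ->
  is_gateaux I (cfc f) (opath t) (B - A) (npath t).
Proof.
move=> t1; rewrite /npath /nabla; case: xgetP => [L _ //|h].
have bBA : bounded_op (B - A).
  by apply: bounded_opB; [case: SA_B => -[]|case: SA_A => -[]].
have seg : segment A B (opath t) by exists t.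
by have [L hL] := f_diff seg bBA; case: (h L).
Qed.

Lemma bounded_npath t : t \in `[0, 1] -> bounded_op (npath t).
Proof. by move=> /gateaux_npath[]. Qed.

(** Moving from [t] to [s] along [B - A] stays on the segment, hence in [SA I], so every [s] in
    [[0, 1]] is admissible in the strong limit. The second vector [y] serves for the symmetry of the
    derivative. *)
Lemma npath_slope x y t : t \in `[0, 1] ->
  unit_slope (fun t => rdot (fpath t x) y) t (rdot (npath t x) y).
Proof.
move=> t1 e e0; have [_ /(_ x)/cvg_nm h] := gateaux_npath t1.
have y1 : 0 < nm y + 1 by rewrite ltr_wpDl ?nm_ge0.
have e1 : 0 < e / (nm y + 1) by rewrite divr_gt0.
have := h _ e1; rewrite !near_withinE => -[r /= r0 hr].
exists r => // s s1 st; have [->|s0] := eqVneq s t.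
  by rewrite !subrr mulr0 normr0 subr0 normr0 mulr0.
have k0 : s - t != 0 by rewrite subr_eq0.
have := hr (s - t); rewrite /= sub0r normrN => /(_ st k0).
rewrite path_step addrC subrK => /(_ (SA_path s1)) hn.
have -> : rdot (fpath s x) y - rdot (fpath t x) y - rdot (npath t x) y * (s - t) =
  (s - t) * rdot ((s - t)^-1%:C *: (fpath s x - fpath t x) - npath t x) y.
  by rewrite rdotBl rdotZl rdotBl; field.
rewrite normrM mulrC ler_wpM2r//.
apply: le_trans (rdot_abs_le _ _) _.
apply: le_trans (_ : e / (nm y + 1) * (nm y + 1) <= _); last by rewrite divfK// gt_eqF.
apply: ler_pM; rewrite ?nm_ge0 ?lerDl//.
by rewrite nm_sub ltW.
Qed.

(** Since [f] has selfadjoint values on the path, [<N x, y>] and [<x, N y>] are slopes of the same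
    function of [t], and slopes are unique. *)
Lemma selfadjoint_npath t : t \in `[0, 1] -> selfadjoint (npath t).
Proof.
move=> t1; apply/selfadjointP; split; first exact: bounded_npath.
move=> x y; apply: (unit_slope_unique t1); first exact: npath_slope.
have -> : (fun t => rdot (fpath t x) y) = (fun t => rdot (fpath t y) x).
  apply/funext => s; have /selfadjointP[_ ->] := selfadjoint_fpath s.
  exact: rdotC.
by rewrite rdotC; exact: npath_slope.
Qed.

(** Each form of the path has slopes between its slopes at [0] and [1], which are bounded by
    multiples of [|x|^2]. The increment is selfadjoint, so the bound on its form is a bound on its
    norm. This is the continuity that makes the path Bochner integrable. *)
Lemma fpath_lipschitz : exists2 C : R, 0 <= C & forall (s t : R) (x : H),
  s \in `[0, 1] -> t \in `[0, 1] -> nm ((fpath t - fpath s) x) <= C * `|t - s| * nm x.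
Proof.
have I0 : 0 \in `[0%R, 1%R :> R] by rewrite in_itv /= lexx ler01.
have I1 : 1 \in `[0%R, 1%R :> R] by rewrite in_itv /= lexx ler01.
have [d hd hb] : exists2 d : R -> H -> R,
    (forall x t, t \in `[0%R, 1%R] -> unit_slope (fun t => rdot (fpath t x) x) t (d t x)) &
    forall u, u \in `[0%R, 1%R] -> exists2 k : R, 0 <= k &
      forall x, `|d u x| <= k * nm x ^+ 2.
  exists (fun t x => rdot (npath t x) x); first by move=> x t; exact: npath_slope.
  move=> u u1; have bu := bounded_npath u1; exists (opnorm (npath u)).
    exact: opnorm_ge0.
  move=> x; apply: le_trans (rdot_abs_le _ _) _.
  by rewrite expr2 mulrA ler_wpM2r ?nm_ge0 ?opnormP.
have [a0 a00 e0'] := hb _ I0; have [a1 a10 e1'] := hb _ I1.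
pose C : R := a0 + a1.
have C0 : 0 <= C by rewrite /C; lra.
exists C => // s t.
wlog st : s t / s <= t => [wl x s1 t1|].
  have [|ts] := leP s t; first by move=> st; exact: wl.
  by rewrite opE nm_sub distrC -opE; apply: wl => //; exact: ltW.
move=> x s1 t1; rewrite ger0_norm ?subr_ge0//.
apply: selfadjoint_form_bound; last move=> {}x.
- by apply: selfadjointB; exact: selfadjoint_fpath.
- by rewrite mulr_ge0// subr_ge0.
rewrite opE rdotBl.
have /= /andP[h1 h2] := convex_increment (d := d^~ x) (@fpath_convex x) (hd x) s1 t1 st.
move: (rdot (fpath t x) x - _) h1 h2 => D h1 h2.
have st0 : 0 <= t - s by rewrite subr_ge0.
move: h1 h2 (e0' x) (e1' x).
move: (d 0 x) (d 1 x) => q0 q1 h1 h2 e0 e1.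
have x2 := sqr_ge0 (nm x).
have m0 := mulr_ge0 a00 x2; have m1 := mulr_ge0 a10 x2.
rewrite !ler_norml in e0 e1 *; move: e0 e1 => /andP[e0 _] /andP[_ e1].
have k0 : - (C * nm x ^+ 2) <= q0 by apply: le_trans e0; rewrite /C; lra.
have k1 : q1 <= C * nm x ^+ 2 by apply: le_trans e1 _; rewrite /C; lra.
have := ler_wpM2r st0 k0; have := ler_wpM2r st0 k1.
by move=> l1 l0; apply/andP; split; lra.
Qed.

End Path.

(** * Integral inequalities on the unit interval *)

Section FTC.
Context {R : realType}.
Implicit Types (u h : R -> R) (a b c e s t x y : R).
Local Notation mu := (@lebesgue_measure R).

(** Let [c] be the supremum of the points reached from [a]. The local hypothesis at [c] links it to
    points reached just before it, so [c] is reached, and to points just after it, so [c] cannot be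
    below [b]. *)
Lemma interval_induction (Q : R -> R -> Prop) a b : a <= b ->
  (forall x, Q x x) ->
  (forall x y z, a <= x -> x <= y -> y <= z -> z <= b -> Q x y -> Q y z -> Q x z) ->
  (forall t, a <= t <= b -> exists2 r : R, 0 < r & forall s, a <= s <= b ->
     `|s - t| < r -> (s <= t -> Q s t) /\ (t <= s -> Q t s)) ->
  Q a b.
Proof.
move=> ab Qxx Qtr Qloc; pose S := [set x | a <= x <= b /\ Q a x].
have Sa : S a by split=> //; rewrite lexx.
have ubS : ubound S b by move=> x [/andP[]].
have supS : has_sup S by split; [exists a|exists b].
pose c := sup S.
have ac : a <= c by apply: ub_le_sup Sa; exists b.
have cb : c <= b by apply: ge_sup ubS; exists a.
have [|r r0 hr] := Qloc c; first by rewrite ac.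
have Qac : Q a c.
  have [x [/andP[ax xb] Qax] cx] := sup_adherent r0 supS.
  have xc : x <= c by apply: ub_le_sup; [exists b|split=> //; rewrite ax].
  have [|| /(_ xc) Qxc _] := hr x; first by rewrite ax.
    by rewrite ler0_norm ?subr_le0// opprB ltrBlDr -ltrBlDl -/c.
  exact: Qtr Qax Qxc.
have [cb'|bc] := ltP c b; last by have -> : b = c by apply/eqP; rewrite eq_le bc.
pose s := Num.min (c + r / 2) b.
have cs : c < s by rewrite lt_min cb' andbT ltrDl divr_gt0.
have sb : s <= b by rewrite ge_min lexx orbT.
have sI : a <= s <= b by rewrite sb andbT (le_trans ac)// ltW.
have [|_ /(_ (ltW cs)) Qcs] := hr s sI.
  rewrite gtr0_norm ?subr_gt0//.
  have : s <= c + r / 2 by rewrite ge_min lexx.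
  by lra.
have /(ub_le_sup (proj2 supS)) : S s by split=> //; apply: Qtr Qac Qcs => //; exact: ltW.
by rewrite leNgt -/c cs.
Qed.

(** Upper bound [c] for all difference quotients between [t] and nearby points on either side: a
    local form of the two upper Dini derivates at [t] being at most [c]. *)
Definition dini_le u a b t c := exists2 r : R, 0 < r & forall s, a <= s <= b ->
  `|s - t| < r -> (s <= t -> u t - u s <= c * (t - s)) /\
                  (t <= s -> u s - u t <= c * (s - t)).

(* The levels [k e <= h < (k + 1) e] are enlarged to open sets of nearly the same
   measure, so that the bound by the measure holds in a neighbourhood of every
   point. *)
Lemma dini_integral_le u h a b : a <= b ->
  measurable_fun (`[a, b] : set R) h ->
  (forall t, a <= t <= b -> 0 <= h t) ->
  (forall t c, a <= t <= b -> h t < c -> dini_le u a b t c) ->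
  ((u b - u a)%:E <= \int[mu]_(t in `[a, b]) (h t)%:E)%E.
Proof.
move=> ab mh h0 hu; apply/lee_addgt0Pr => e0; rewrite -[e0]/(e0 : R) => e0p.
have ba1 : 0 < b - a + 1 by lra.
(* The total error is [e (b - a)] from rounding [h] up to a multiple of [e], plus [e] from enlarging
   the levels. *)
have [e ep ee] : exists2 e : R, 0 < e & e * (b - a + 1) = e0.
  by exists (e0 / (b - a + 1)); [rewrite divr_gt0|rewrite divfK ?gt_eqF].
have mI : measurable (`[a, b] : set R) by exact: measurable_itv.
pose lev k : set R := `[a, b] `&` h @^-1` `[k%:R * e, k.+1%:R * e[.
have mlev k : measurable (lev k) by apply: mh => //; exact: measurable_itv.
have levI k : lev k `<=` `[a, b] by move=> x [].
have mulev k : (mu (lev k) < +oo)%E.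
  apply: le_lt_trans (le_measure mu (mem_set (mlev k)) (mem_set mI) (levI k)) _.
  by rewrite /= lebesgue_measure_itv /=; case: ifP; rewrite ?ltry.
(* The excess measure allowed at level [k]: weighted by [(k + 1) e] it is [e / 2^(k + 1)], which
   sums to [e]. *)
have dp k : 0 < e / (2 ^ k.+1)%:R / (k.+1%:R * e).
  have ke : 0 < k.+1%:R * e by rewrite mulr_gt0.
  have k2 : 0 < (2 ^ k.+1)%:R :> R by rewrite ltr0n expn_gt0.
  exact: divr_gt0 (divr_gt0 ep k2) ke.
pose U k := sval (cid (lebesgue_regularity_outer (mlev k) (mulev k) (dp k))).
have [oU levU muU] : [/\ forall k, open (U k), forall k, lev k `<=` U k &
    forall k, (mu (U k `\` lev k) < (e / (2 ^ k.+1)%:R / (k.+1%:R * e))%:E)%E].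
  by split=> k; rewrite /U; case: cid => V [].
have mU k : measurable (U k) by exact: open_measurable.
pose G k (t : R) : \bar R := (k.+1%:R * e * \1_(U k) t)%:E.
have ke k : 0 < k.+1%:R * e by rewrite mulr_gt0.
have G0 k t : (0 <= G k t)%E by rewrite lee_fin mulr_ge0// ltW.
have mG k (D : set R) : measurable_fun D (G k).
  by apply/measurable_EFinP; apply: measurable_funM => //; exact: measurable_indic.
pose g t : \bar R := (\sum_(k <oo) G k t)%E.
have g0 t : (0 <= g t)%E by apply: nneseries_ge0.
have Gg k t : (G k t <= g t)%E.
  by rewrite /g (@nneseriesD1 _ _ k xpredT)// leeDl//; exact: nneseries_ge0.
have mg (D : set R) : measurable D -> measurable_fun D g.
  by move=> mD; apply: ge0_emeasurable_sum.
have mS (x y : R) : measurable (`]x, y] : set R) by exact: measurable_itv.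
have intG k (D : set R) : measurable D ->
    (\int[mu]_(t in D) G k t = (k.+1%:R * e)%:E * mu (U k `&` D))%E.
  move=> mD; rewrite /G; under eq_integral do rewrite EFinM.
  rewrite ge0_integralZl ?lee_fin ?(ltW (ke _))//.
    by rewrite integral_indic//; exact: mU.
  by apply/measurable_EFinP; apply: measurable_indic; exact: mU.
have main : ((u b - u a)%:E <= \int[mu]_(t in `]a, b]) g t)%E.
  pose Q x y := ((u y - u x)%:E <= \int[mu]_(t in `]x, y]) g t)%E.
  apply: (@interval_induction Q a b) => //.
  - move=> x; rewrite /Q subrr; exact: integral_ge0.
  - move=> x y z ax xy yz zb; rewrite /Q => Qxy Qyz.
    have -> : `]x, z]%classic = `]x, y] `|` `]y, z] :> set R.
      by rewrite (@itv_bndbnd_setU _ _ _ (BRight y)) ?bnd_simp.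
    rewrite ge0_integral_setU//; last 2 first.
      by apply: mg; exact: measurableU.
      rewrite disj_set2E; apply/eqP; rewrite -subset0 => w [] /=.
      by rewrite !in_itv /= => /andP[_ wy] /andP[/lt_le_trans/(_ wy)]; rewrite ltxx.
    apply: le_trans (leeD Qxy Qyz); rewrite -EFinD lee_fin.
    by lra.
  - move=> t tI; pose k := Num.trunc (h t / e).
    have hte : 0 <= h t / e by rewrite divr_ge0 ?h0// ltW.
    have tlev : lev k t.
      split; rewrite /= in_itv //=.
      have /andP[k1 k2] := truncn_itv hte.
      by rewrite -ler_pdivlMr// k1 -ltr_pdivrMr.
    have tU := levU _ _ tlev.
    have [r r0 hr] := hu t (k.+1%:R * e) tI ltac:(by case: tlev => _ /=; rewrite in_itv => /andP[]).
    (* Short intervals around [t] lie in [U k], where [g >= (k + 1) e > h t]; there the slope bound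
       [(k + 1) e] compares directly with the integral of [g]. *)
    have /nbhs_ballP[r' r'0 hr'] : nbhs t (U k) by apply: open_nbhs_nbhs; split.
    exists (Num.min r r'); first by rewrite lt_min r0 r'0.
    have small x y : x <= y -> `|x - t| < r' -> `|y - t| < r' ->
        u y - u x <= k.+1%:R * e * (y - x) -> Q x y.
      move=> xy xt yt hxy; rewrite /Q.
      apply: (@le_trans _ _ (\int[mu]_(t in `]x, y]) G k t)%E); last first.
        apply: ge0_le_integral => //; try exact: mG; try exact: mg.
      rewrite intG// (_ : U k `&` _ = `]x, y]%classic); last first.
        apply/seteqP; split=> [z []//|z zxy]; split=> //; apply: hr'.
        rewrite -ball_normE /=; move: zxy; rewrite /= in_itv /= => /andP[xz zy].
        by move: xt yt; rewrite !ltr_norml => /andP[? ?] /andP[? ?]; apply/andP; split; lra.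
      rewrite lebesgue_measure_itv /= lte_fin.
      move: xy; rewrite le_eqVlt => /predU1P[->|xy].
        by rewrite ltxx mule0 subrr.
      by rewrite xy -EFinD -EFinM lee_fin.
    have tt : `|t - t| < r' by rewrite subrr normr0.
    move=> s sI; rewrite lt_min => /andP[sr sr'].
    have [h1 h2] := hr s sI sr.
    by split=> st; apply: small => //; [exact: h1|exact: h2].
apply: (le_trans main).
rewrite /g integral_nneseries//; last by move=> k; exact: mG.
have lev_disj : trivIset setT lev.
  apply/trivIsetP => i j _ _; wlog ij : i j / (i < j)%N => [wl|].
    by rewrite neq_ltn => /orP[|] ij; [|rewrite setIC]; apply: wl; rewrite ?lt_eqF.
  move=> _; rewrite -subset0 => t [[_ /=]].
  rewrite in_itv /= => /andP[_ t1] [_ /=]; rewrite in_itv /= => /andP[t2 _].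
  have := le_lt_trans t2 t1; rewrite ltr_pM2r// ltr_nat ltnS leqNgt.
  by rewrite ij.
have lev_cover : `[a, b]%classic = \bigcup_k lev k.
  apply/seteqP; split=> [t tI|t [k _ []]//].
  exists (Num.trunc (h t / e)) => //; split=> //=; rewrite in_itv /=.
  have hte : 0 <= h t / e by rewrite divr_ge0 ?h0// ?(ltW ep)//; move: tI; rewrite /= in_itv.
  have /andP[k1 k2] := truncn_itv hte.
  by rewrite -ler_pdivlMr// k1 -ltr_pdivrMr.
pose h' t : \bar R := (h t + e)%:E.
have mh' : measurable_fun `[a, b] h'.
  by apply/measurable_EFinP; apply: measurable_funD.
have h'0 t : `[a, b]%classic t -> (0 <= h' t)%E.
  by rewrite /= in_itv /= => /h0 ht; rewrite lee_fin addr_ge0// ltW.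
apply: (@le_trans _ _ (\sum_(k <oo) (\int[mu]_(t in lev k) h' t + (e / (2 ^ k.+1)%:R)%:E))%E).
  apply: lee_nneseries => [k _ _|k _]; first exact: integral_ge0.
  rewrite intG//; apply: (@le_trans _ _ ((k.+1%:R * e)%:E * mu (U k))%E).
    rewrite lee_wpmul2l ?lee_fin ?(ltW (ke _))//.
    apply: le_measure; [apply/mem_set|apply/mem_set|by move=> ? []].
      by apply: measurableI; [exact: mU|exact: mS].
    exact: mU.
  (* On the level itself [(k + 1) e <= h + e]; the remainder has the prescribed small measure. *)
  have -> : mu (U k) = (mu (lev k) + mu (U k `\` lev k))%E.
    rewrite -[in LHS](setDUK (levU k)) measureU//; try exact: mlev; try exact: setDIK; last first.
      by apply: measurableD; [exact: mU|exact: mlev].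
  rewrite ge0_muleDr//; apply: leeD.
    rewrite -(integral_cst mu (mlev k)); apply: ge0_le_integral => //.
    - exact: mlev.
    - by move=> t _; rewrite lee_fin (ltW (ke _)).
    - by apply: measurable_funS mh'.
    - move=> t [_ /=]; rewrite in_itv /= => /andP[kh _].
      by rewrite lee_fin -natr1 mulrDl mul1r lerD2r.
  apply: (@le_trans _ _ ((k.+1%:R * e)%:E * (e / (2 ^ k.+1)%:R / (k.+1%:R * e))%:E)%E).
    by rewrite lee_wpmul2l ?lee_fin ?(ltW (ke _))// ltW.
  by rewrite -EFinM lee_fin mulrC divfK// gt_eqF.
apply: le_trans (epsilon_trick _ _ _) _; last 1 first.
- rewrite -ge0_integral_bigcup// -?lev_cover//.
  rewrite /h'; under eq_integral do rewrite EFinD.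
  have -> : (\int[mu]_(t in `[a, b]) ((h t)%:E + e%:E) =
      \int[mu]_(t in `[a, b]) (h t)%:E + \int[mu]_(t in `[a, b]) e%:E)%E.
    apply: ge0_integralD => //.
      exact/measurable_EFinP.
    by move=> t _; rewrite lee_fin ltW.
  rewrite -addeA leeD2l// integral_cst// /= lebesgue_measure_itv /= lte_fin.
  have -> : e0%:E = (e * (b - a) + e)%:E by rewrite -ee mulrDr mulr1.
  move: ab; rewrite le_eqVlt => /predU1P[->|ab].
    by rewrite ltxx mule0 add0e lee_fin subrr mulr0 add0r.
  by rewrite ab.
- move=> k; apply: integral_ge0 => t /levI; exact: h'0.
- exact: ltW.
Qed.

End FTC.

(** * Measurability by monotonicity; bounded measurable functions on the open unit interval *)

Section Unit.
Context {R : realType}.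
Implicit Types (u v h : R -> R) (a b c s t C P Q : R).
Local Notation mu := (@lebesgue_measure R).
Local Notation U := (`]0%R, 1%R[%classic : set (measurableTypeR R)).
Local Notation I01 := (`[0%R, 1%R]%classic : set (measurableTypeR R)).

(** Clamping the argument to [[a, b]] makes the function monotone on the whole line, hence
    measurable. *)
Lemma monotone_extension u a b : a <= b ->
  (forall s t, a <= s -> s <= t -> t <= b -> u s <= u t) ->
  exists2 v : R -> R, measurable_fun [set: R] v & forall t, a <= t <= b -> v t = u t.
Proof.
move=> ab hu; exists (fun t => u (Num.max a (Num.min t b))).
  apply: nondecreasing_measurable => // s t st; apply: hu.
  - by rewrite le_max lexx.
  - have ms : Num.min s b <= Num.min t b by rewrite le_min !ge_min st lexx orbT.
    by rewrite ge_max !le_max lexx ms orbT.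
  - by rewrite ge_max ab ge_min lexx orbT.
by move=> t /andP[ta tb]; rewrite min_l// max_r.
Qed.

Lemma monotone_measurable u : (forall s t, 0 <= s -> s <= t -> t <= 1 -> u s <= u t) ->
  measurable_fun I01 u.
Proof.
move=> /(monotone_extension ler01)[v mv vu].
apply: eq_measurable_fun (measurable_funTS mv) => t; rewrite inE /= in_itv /= => tI.
by rewrite vu.
Qed.

(** Such a function is a monotone function of the fold [min t (1 - t)]. *)
Lemma symmetric_monotone_measurable u :
  (forall t, 0 <= t <= 1 -> u (1 - t) = u t) ->
  (forall s t, 0 <= s -> s <= t -> t <= 2^-1 -> u s <= u t) ->
  measurable_fun I01 u.
Proof.
have h0 : 0 <= 2^-1 :> R by rewrite invr_ge0.
move=> us /(monotone_extension h0)[v mv vu].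
have mm : measurable_fun [set: R] (fun t => v (Num.min t (1 - t))).
  apply: measurableT_comp => //; apply: measurable_minr => //.
  by apply: measurable_funB.
apply: eq_measurable_fun (measurable_funTS mm) => t; rewrite inE /= in_itv /= => tI.
have [t0 t1] := andP tI.
rewrite /Num.min; case: ifPn => [th|]; last rewrite -leNgt => th.
  by rewrite vu//; apply/andP; split; lra.
by rewrite vu ?us//; apply/andP; split; lra.
Qed.

Lemma mU : measurable U.
Proof. exact: measurable_itv. Qed.

Lemma muU : mu U = 1%E.
Proof. by rewrite lebesgue_measure_itv /= lte_fin ltr01 oppr0 adde0. Qed.

(** Boundedness makes this class of integrable functions closed under products as well as sums,
    which the covariances below require. *)
Definition bmf u := measurable_fun U u /\
  exists2 C : R, 0 <= C & forall t, 0 < t < 1 -> `|u t| <= C.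

Lemma bmf_integrable u : bmf u -> mu.-integrable U (EFin \o u).
Proof.
move=> [m [C C0 hC]]; apply: measurable_bounded_integrable => //; try exact: mU.
  by have := muU; rewrite /= => ->; rewrite ltry.
exists C; split; first exact: num_real.
move=> M CM t; rewrite /= in_itv /= => tI; exact: le_trans (hC t tI) (ltW CM).
Qed.

Lemma bmf_cst c : bmf (cst c).
Proof. by split=> //; exists `|c|. Qed.

Lemma bmfD u v : bmf u -> bmf v -> bmf (fun t => u t + v t).
Proof.
move=> [mu' [C C0 hC]] [mv [D D0 hD]]; split; first exact: measurable_funD.
exists (C + D); first exact: addr_ge0.
by move=> t tI; apply: le_trans (ler_normD _ _) (lerD (hC t tI) (hD t tI)).
Qed.

Lemma bmfM u v : bmf u -> bmf v -> bmf (fun t => u t * v t).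
Proof.
move=> [mu' [C C0 hC]] [mv [D D0 hD]]; split; first exact: measurable_funM.
exists (C * D); first exact: mulr_ge0.
by move=> t tI; rewrite normrM ler_pM ?hC ?hD.
Qed.

Lemma bmfZ c u : bmf u -> bmf (fun t => c * u t).
Proof. exact: bmfM (bmf_cst c). Qed.

End Unit.

Ltac bmf_tac := repeat first [assumption | exact (bmf_cst _) |
  refine (bmfD _ _) | refine (bmfZ _ _) | refine (bmfM _ _)].

Section UnitIntegral.
Context {R : realType}.
Implicit Types (u v h : R -> R) (a b c s t C P Q : R).
Local Notation mu := (@lebesgue_measure R).
Local Notation U := (`]0%R, 1%R[%classic : set (measurableTypeR R)).
Local Notation I01 := (`[0%R, 1%R]%classic : set (measurableTypeR R)).

Definition J u : R := \int[mu]_(t in U) u t.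

Lemma JD u v : bmf u -> bmf v -> J (fun t => u t + v t) = J u + J v.
Proof.
by move=> bu bv; apply: RintegralD; [exact: mU|exact: bmf_integrable..].
Qed.

Lemma JZ c u : bmf u -> J (fun t => c * u t) = c * J u.
Proof. by move=> bu; apply: RintegralZl; [exact: mU|exact: bmf_integrable]. Qed.

Lemma J_cst c : J (fun=> c) = c.
Proof.
rewrite /J Rintegral_cst; last exact: mU.
by have := muU; rewrite /= => ->; rewrite mulr1.
Qed.

Lemma J_eq u v : (forall t, 0 < t < 1 -> u t = v t) -> J u = J v.
Proof.
by move=> uv; apply: eq_Rintegral => t; rewrite inE /= in_itv /= => /uv.
Qed.

Lemma J_ge0 u : (forall t, 0 < t < 1 -> 0 <= u t) -> 0 <= J u.
Proof.
move=> u0; apply: Rintegral_ge0 => t; rewrite /= in_itv /=; exact: u0.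
Qed.

Lemma J_le u v : bmf u -> bmf v -> (forall t, 0 < t < 1 -> u t <= v t) -> J u <= J v.
Proof.
move=> bu bv uv; rewrite -subr_ge0.
have -> : J v - J u = J (fun t => v t + (-1) * u t).
  by rewrite JD ?JZ ?mulN1r//; exact: bmfZ.
by apply: J_ge0 => t /uv; lra.
Qed.

Lemma J_Rintegral_cc u : bmf u -> \int[mu]_(t in `[0%R, 1%R]) u t = J u.
Proof.
move=> bu; rewrite -Rintegral_itv_obnd_cbnd.
  by rewrite -Rintegral_itv_bndo_bndc//; exact: bmf_integrable.
have := bmf_integrable bu.
have [m [C C0 hC]] := bu.
move=> _; apply: (@measurable_bounded_integrable _ _ _ mu (fun t => u t)) => //.
- by rewrite /= lebesgue_measure_itv /=; case: ifP; rewrite ?ltry.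
- by apply/measurable_fun_itv_bndo_bndcP.
exists (Num.max C `|u 1|); split; first exact: num_real.
move=> M; rewrite gt_max => /andP[CM uM] t; rewrite /= in_itv /= => /andP[t0].
rewrite le_eqVlt => /predU1P[->|t1]; first exact: ltW.
by apply: le_trans (hC t _) (ltW CM); rewrite t0.
Qed.

(* Integrate (u s - u t) (v s - v t) >= 0 over s, then over t. *)
Lemma chebyshev u v : bmf u -> bmf v ->
  (forall s t, 0 < s < 1 -> 0 < t < 1 -> 0 <= (u s - u t) * (v s - v t)) ->
  J u * J v <= J (fun t => u t * v t).
Proof.
move=> bu bv huv; have buv := bmfM bu bv; set X := J (fun t => u t * v t).
have h t : 0 < t < 1 -> 0 <= X + (- v t * J u + (- u t * J v + u t * v t)).
  move=> tI.
  have -> : X + (- v t * J u + (- u t * J v + u t * v t)) =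
     J (fun s => u s * v s + (- v t * u s + (- u t * v s + u t * v t))).
    rewrite JD; bmf_tac.
    rewrite JD; bmf_tac.
    rewrite JD; bmf_tac.
    rewrite J_cst.
    rewrite JZ; bmf_tac.
    rewrite JZ; bmf_tac.
    by [].
  by apply: J_ge0 => s sI; have := huv s t sI tI; lra.
have := J_ge0 h.
have -> : J (fun t => X + (- v t * J u + (- u t * J v + u t * v t))) =
   X + (- J u * J v + (- J v * J u + X)).
  have -> : J (fun t => X + (- v t * J u + (- u t * J v + u t * v t))) =
      J (fun t => X + (- J u * v t + (- J v * u t + u t * v t))).
    by apply: J_eq => t _; ring.
  rewrite JD; bmf_tac.
  rewrite JD; bmf_tac.
  rewrite JD; bmf_tac.
  rewrite J_cst.
  rewrite JZ; bmf_tac.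
  rewrite JZ; bmf_tac.
  by [].
by lra.
Qed.

(** Read [a], [b], [X] as the means of [u], [v], [u v] with [0 <= u <= P] and [0 <= v <= Q]. If
    [Q a <= P b], then [X - a b <= Q a - a b <= Q a (P - a) / P], and [a (P - a) <= P^2 / 4]; the
    other case is symmetric. *)
Lemma gruss_arith (a b X P Q : R) : 0 <= a -> a <= P -> 0 <= b -> b <= Q ->
  X <= Q * a -> X <= P * b -> X - a * b <= P * Q / 4.
Proof.
move=> a0 aP b0 bQ XQ XP.
have [P0|P0] := leP P 0.
  have az : a = 0 by lra.
  have pz : P = 0 by lra.
  by rewrite az pz !mul0r subr0 in XP *; lra.
have sq := sqr_ge0 (P - 2 * a); have sqb := sqr_ge0 (Q - 2 * b).
have [Q0|Q0] := leP Q 0.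
  have bz : b = 0 by lra.
  have qz : Q = 0 by lra.
  by rewrite bz qz !mul0r !mulr0 subr0 in XQ *; lra.
have [h|h] := leP (Q * a) (P * b).
  apply: (@le_trans _ _ (Q * a - a * b)); first by lra.
  rewrite -(ler_pM2l P0).
  have h1 : a * (Q * a) <= a * (P * b) by rewrite ler_wpM2l.
  have h2 : 0 <= Q * (P - 2 * a) ^+ 2 by rewrite mulr_ge0// ltW.
  by rewrite expr2 in h2; nra.
apply: (@le_trans _ _ (P * b - a * b)); first by lra.
rewrite -(ler_pM2l Q0).
have h1 : b * (P * b) <= b * (Q * a) by rewrite ler_wpM2l// ltW.
have h2 : 0 <= P * (Q - 2 * b) ^+ 2 by rewrite mulr_ge0// ltW.
by rewrite expr2 in h2; nra.
Qed.

Lemma bmf_floor u P : bmf u -> (forall s t, 0 < s < 1 -> 0 < t < 1 -> u s - u t <= P) ->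
  exists m, forall t, 0 < t < 1 -> 0 <= u t + m <= P.
Proof.
move=> [_ [C C0 hC]] hP; pose E := [set u t | t in [set t | 0 < t < 1]].
have hI : 0 < (2^-1 : R) < 1 by apply/andP; split; lra.
have E0 : E !=set0 by exists (u 2^-1), 2^-1.
have lbE : has_lbound E.
  exists (- C) => _ [t /= tI <-]; have := hC t tI; rewrite ler_norml.
  by move=> /andP[].
exists (- inf E) => t tI; rewrite subr_ge0 ge_inf//=; last by exists t.
rewrite lerBlDr -lerBlDl; apply: lb_le_inf => // _ [s /= sI <-].
by have := hP t s tI sI; lra.
Qed.

(** The covariance ignores additive constants, so the functions may be moved into [[0, P]] and
    [[0, Q]]; there [u' v'] is pointwise at most [Q u'] and at most [P v']. *)
Lemma gruss u v P Q : bmf u -> bmf v ->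
  (forall s t, 0 < s < 1 -> 0 < t < 1 -> u s - u t <= P) ->
  (forall s t, 0 < s < 1 -> 0 < t < 1 -> v s - v t <= Q) ->
  J (fun t => u t * v t) - J u * J v <= P * Q / 4.
Proof.
move=> bu bv /(bmf_floor bu)[m hm] /(bmf_floor bv)[n hn].
pose u' t := u t + m; pose v' t := v t + n.
have bu' : bmf u' by apply: bmfD => //; exact: bmf_cst.
have bv' : bmf v' by apply: bmfD => //; exact: bmf_cst.
have buv' := bmfM bu' bv'.
have Ju' : J u' = J u + m by rewrite JD ?J_cst//; exact: bmf_cst.
have Jv' : J v' = J v + n by rewrite JD ?J_cst//; exact: bmf_cst.
have Juv' : J (fun t => u' t * v' t) = J (fun t => u t * v t) + (n * J u + (m * J v + m * n)).
  rewrite -(J_cst (m * n)) -!JZ; bmf_tac; rewrite -!JD; bmf_tac.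
  by apply: J_eq => t _; rewrite /u' /v'; ring.
have -> : J (fun t => u t * v t) - J u * J v = J (fun t => u' t * v' t) - J u' * J v'.
  by rewrite Juv' Ju' Jv'; ring.
have Jb w K : bmf w -> (forall t, 0 < t < 1 -> 0 <= w t <= K) -> 0 <= J w /\ J w <= K.
  move=> bw hw; split; first by apply: J_ge0 => t /hw/andP[].
  by rewrite -(J_cst K); apply: J_le => //; [exact: bmf_cst|move=> t /hw/andP[]].
have [a0 aP] := Jb _ _ bu' hm; have [b0 bQ] := Jb _ _ bv' hn.
apply: gruss_arith => //.
  rewrite -JZ//; apply: J_le => //; first exact: bmfZ.
  move=> t tI; have /andP[h1 _] := hm t tI; have /andP[_ h2] := hn t tI.
  by rewrite mulrC ler_wpM2r.
rewrite -JZ//; apply: J_le => //; first exact: bmfZ.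
move=> t tI; have /andP[_ h1] := hm t tI; have /andP[h2 _] := hn t tI.
by rewrite ler_wpM2r.
Qed.

Let refl (t : measurableTypeR R) : measurableTypeR R := 1 - t.

Let mrefl : measurable_fun setT refl.
Proof. exact: measurable_funB. Qed.

Let refl_mixin := isMeasurableFun.Build _ _ _ _ _ mrefl.
Let refl_pack : {mfun _ >-> _} := HB.pack refl refl_mixin.

(** Reflection preserves the length of half-open intervals, up to exchanging the closed end, and
    these lengths determine the measure. *)
Lemma lebesgue_measure_onem (A : set (measurableTypeR R)) : measurable A ->
  mu A = pushforward mu refl_pack A.
Proof.
move=> mA; apply: lebesgue_measure_unique => // X [[a b] /= ab <-].
rewrite /pushforward.
have -> : refl_pack @^-1` `]a, b] = `[1 - b, 1 - a[%classic.
  apply/seteqP; split=> t /=; rewrite !in_itv /= /refl => /andP[h1 h2]; apply/andP; split; lra.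
rewrite [RHS]lebesgue_measure_itv [LHS]lebesgue_measure_itv /= !lte_fin.
have -> : (1 - b < 1 - a) = (a < b) by rewrite ltrD2l ltrN2.
by case: ifP => // _; rewrite -!EFinD; congr (_%:E); ring.
Qed.

Lemma ge0_integral_onem (f : R -> \bar R) : measurable_fun U f ->
  (forall t, 0 < t < 1 -> (0 <= f t)%E) ->
  (\int[mu]_(t in U) f (1 - t)%R = \int[mu]_(t in U) f t)%E.
Proof.
move=> mf f0; rewrite [RHS](eq_measure_integral (pushforward mu refl_pack)); last first.
  by move=> A mA _; exact: lebesgue_measure_onem.
rewrite ge0_integral_pushforward//; try exact: mU; last first.
  by move=> t; rewrite inE /= in_itv /=; exact: f0.
congr (integral _ _ _); apply/seteqP; split=> t /=; rewrite !in_itv /= /refl => /andP[h1 h2]; apply/andP; split; lra.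
Qed.

Lemma bmf_onem u : bmf u -> bmf (fun t => u (1 - t)).
Proof.
move=> [m [C C0 hC]]; split; last first.
  by exists C => // t /andP[h1 h2]; apply: hC; apply/andP; split; lra.
apply: (measurable_comp (F := U) (f := u) (g := refl)) => //.
- by move=> _ [t /= + <-]; rewrite !in_itv /= /refl => /andP[h1 h2]; apply/andP; split; lra.
- by apply: measurable_funTS; exact: mrefl.
Qed.

Lemma J_onem u : bmf u -> J (fun t => u (1 - t)) = J u.
Proof.
move=> bu; have [_ [C C0 hC]] := bu.
(* [ge0_integral_onem] takes nonnegative integrands, hence the shift by the bound [C]. *)
have bC : bmf (fun t => u t + C) by apply: bmfD => //; exact: bmf_cst.
suff h : J (fun t => u (1 - t) + C) = J (fun t => u t + C).
  move: h; rewrite !JD ?J_cst//; [exact: addIr|exact: bmf_cst|exact: bmf_onem|exact: bmf_cst].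
rewrite /J /Rintegral; congr fine.
apply: (ge0_integral_onem (f := fun t => (u t + C)%:E)).
  by apply/measurable_EFinP; case: bC.
by move=> t /hC; rewrite ler_norml lee_fin => /andP[h _]; lra.
Qed.

End UnitIntegral.

(** * Oscillation of symmetric functions in terms of their slopes *)

Section Oscillation.
Context {R : realType}.
Implicit Types (u v h g d p : R -> R) (a b c s t P Q : R).
Local Notation mu := (@lebesgue_measure R).
Local Notation U := (`]0%R, 1%R[%classic : set (measurableTypeR R)).

(* AM-GM: h <= (c + h^2 / c) / 2, with c close to the L2 norm. *)
Lemma integral_le_L2 h : measurable_fun U h -> (forall t, 0 < t < 1 -> 0 <= h t) ->
  (\int[mu]_(t in U) (h t ^+ 2)%:E < +oo)%E ->
  (\int[mu]_(t in U) (h t)%:E <=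
   (Num.sqrt (fine (\int[mu]_(t in U) (h t ^+ 2)%:E)))%:E)%E.
Proof.
move=> mh h0; set X := (\int[mu]_(t in U) (h t ^+ 2)%:E)%E => Xoo.
have X0 : (0 <= X)%E by apply: integral_ge0 => t _; rewrite lee_fin sqr_ge0.
have Xfin : X \is a fin_num by rewrite ge0_fin_numE.
set S := Num.sqrt _; have S0 : 0 <= S by exact: sqrtr_ge0.
have SX : S ^+ 2 = fine X by rewrite sqr_sqrtr// fine_ge0.
apply/lee_addgt0Pr => e; rewrite -[e]/(e : R) => e0.
(* The added [e] keeps [c] positive when the L2 norm [S] vanishes. *)
pose c := S + e; have c0 : 0 < c by rewrite /c ltr_wpDl.
rewrite -EFinD -/c.
have hU t : U t -> (0 <= (h t)%:E)%E by rewrite /= in_itv /= lee_fin; exact: h0.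
have mh2 : measurable_fun U (fun t => (h t ^+ 2)%:E).
  by apply/measurable_EFinP; exact: measurable_funX.
apply: (@le_trans _ _ (\int[mu]_(t in U) ((c / 2)%:E + ((2 * c)^-1)%:E * (h t ^+ 2)%:E))%E).
  apply: ge0_le_integral => //; try exact: mU.
  - exact/measurable_EFinP.
  - by apply: emeasurable_funD => //; exact: measurable_funeM.
  - move=> t _; rewrite -EFinM -EFinD lee_fin -subr_ge0.
    have -> : c / 2 + (2 * c)^-1 * h t ^+ 2 - h t = (c - h t) ^+ 2 / (2 * c).
      by field; rewrite gt_eqF.
    by rewrite divr_ge0 ?sqr_ge0// mulr_ge0// ltW.
have c2 : 0 <= c / 2 by rewrite divr_ge0// ltW.
have ci : 0 <= (2 * c)^-1 by rewrite invr_ge0 mulr_ge0// ltW.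
rewrite ge0_integralD//; try exact: mU; last 2 first.
  by move=> t _; rewrite -EFinM lee_fin mulr_ge0 ?sqr_ge0.
  exact: measurable_funeM.
rewrite integral_cst; last exact: mU.
rewrite ge0_integralZl//; try exact: mU; last first.
  by move=> t _; rewrite lee_fin sqr_ge0.
rewrite [X in (_ * X + _)%E](_ : _ = 1%E); last exact: muU.
rewrite mule1 -/X -(fineK Xfin) -EFinM -EFinD lee_fin -SX.
rewrite -subr_ge0.
have -> : c - (c / 2 + (2 * c)^-1 * S ^+ 2) = (c ^+ 2 - S ^+ 2) / (2 * c).
  by field; rewrite gt_eqF.
rewrite divr_ge0 ?mulr_ge0 ?(ltW c0)// subr_ge0 lerXn2r ?nnegrE ?(ltW c0)//.
by rewrite /c lerDl ltW.
Qed.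

(** The common shape of [p] with [|p'|] and of the symmetrized convex form with a multiple of the
    norm of the derivative gap, so that one oscillation estimate serves both. *)
Definition slope_bound u h := forall t c, 0 < t < 1 -> h t < c ->
  exists2 r : R, 0 < r & forall s, 0 < s < 1 -> `|s - t| < r -> `|u s - u t| <= c * `|s - t|.

Definition smono u := (forall t, 0 < t < 1 -> u (1 - t) = u t) /\
  (forall s t, 0 < s -> s <= t -> t <= 2^-1 -> u s <= u t).

(** The explicit value of [s] depends on [t] alone, so two functions can be folded to the same point
    and compared there. *)
Lemma smono_fold u t : smono u -> 0 < t < 1 -> exists s, [/\ 0 < s, s <= 2^-1, u s = u t &
  s = Num.min t (1 - t)].
Proof.
move=> [us um] tI; have [t0 t1] := andP tI; exists (Num.min t (1 - t)).
rewrite /Num.min; case: ifPn => [th|]; last rewrite -leNgt => th.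
  by split=> //; lra.
by split=> //; [lra|lra|exact: us].
Qed.

Lemma smono_comonotone u v s t : smono u -> smono v -> 0 < s < 1 -> 0 < t < 1 ->
  0 <= (u s - u t) * (v s - v t).
Proof.
move=> su sv sI tI.
have [s1 [s10 s1h <- s1E]] := smono_fold su sI.
have [t1 [t10 t1h <- t1E]] := smono_fold su tI.
have [s2 [_ _ <- s2E]] := smono_fold sv sI.
have [t2 [_ _ <- t2E]] := smono_fold sv tI.
rewrite s2E t2E -s1E -t1E.
have [_ um] := su; have [_ vm] := sv.
have [st|/ltW ts] := leP s1 t1.
  by rewrite mulr_le0// subr_le0; [exact: um|exact: vm].
by rewrite mulr_ge0// subr_ge0; [exact: um|exact: vm].
Qed.

Lemma smono_osc u P : smono u -> (forall s, 0 < s -> s <= 2^-1 -> u 2^-1 - u s <= P) ->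
  forall s t, 0 < s < 1 -> 0 < t < 1 -> u s - u t <= P.
Proof.
move=> su hP s t sI tI.
have [s1 [s10 s1h <- _]] := smono_fold su sI.
have [t1 [t10 t1h <- _]] := smono_fold su tI.
have [_ um] := su; have := um _ _ s10 s1h (lexx _); have := hP _ t10 t1h.
by lra.
Qed.

Lemma slope_bound_dini u h a b t c : slope_bound u h -> 0 < a -> b < 1 ->
  a <= t <= b -> h t < c -> dini_le u a b t c.
Proof.
move=> sb a0 b1 /andP[ta tb] hc; have [|r r0 hr] := sb t c _ hc.
  by apply/andP; split; lra.
exists r => // s /andP[sa sb'] st; have := hr s _ st.
rewrite ler_norml => /(_ ltac:(by apply/andP; split; lra))/andP[h1 h2].
split=> le; move: h1 h2.
  by rewrite ler0_norm ?subr_le0// opprB; lra.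
by rewrite ger0_norm ?subr_ge0//; lra.
Qed.

(** By symmetry [u] drops over [[1/2, 1 - s]] exactly what it gains over [[s, 1/2]]. Hence twice the
    gain is at most the integral of [h] over both pieces, and this integral is at most the L2
    norm. *)
Lemma slope_bound_osc u h : (forall t, 0 < t < 1 -> u (1 - t) = u t) ->
  measurable_fun U h -> (forall t, 0 < t < 1 -> 0 <= h t) -> slope_bound u h ->
  (\int[mu]_(t in U) (h t ^+ 2)%:E < +oo)%E ->
  forall s, 0 < s -> s <= 2^-1 ->
  u 2^-1 - u s <= 2^-1 * Num.sqrt (fine (\int[mu]_(t in U) (h t ^+ 2)%:E)).
Proof.
move=> us mh h0 sb hoo s s0 sh; have := integral_le_L2 mh h0 hoo.
set X := Num.sqrt _ => hX.
have subU x y (i j : bool) : 0 < x -> y < 1 ->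
    [set` Interval (BSide i x) (BSide j y)] `<=` U.
  move=> x0 y1 t; rewrite /= !in_itv /=.
  by case: i; case: j => /= /andP[h1 h2]; apply/andP; split; lra.
have s1 : 1 - s < 1 by lra.
have hh1 : 2^-1 < 1 :> R by lra.
have hh0 : 0 < 2^-1 :> R by lra.
have i1 : ((u 2^-1 - u s)%:E <= \int[mu]_(t in `[s, 2^-1%R]) (h t)%:E)%E.
  apply: dini_integral_le => //.
  - by apply: measurable_funS mh; [exact: mU|exact: subU].
  - by move=> t /andP[? ?]; apply: h0; apply/andP; split; lra.
  - by move=> t c; exact: slope_bound_dini.
have i2 : ((- u (1 - s) - - u 2^-1)%:E <= \int[mu]_(t in `[2^-1%R, (1 - s)%R]) (h t)%:E)%E.
  apply: (@dini_integral_le _ (fun t => - u t)) => //; first by lra.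
  - by apply: measurable_funS mh; [exact: mU|exact: subU].
  - by move=> t /andP[? ?]; apply: h0; apply/andP; split; lra.
  - move=> t c; apply: slope_bound_dini => //.
    move=> t' c' t'1 hc; have [r r0 hr] := sb _ _ t'1 hc; exists r => // x x1 xt.
    have -> : - u x - - u t' = - (u x - u t') by ring.
    by rewrite normrN; exact: hr.
rewrite us in i2; last by apply/andP; split; lra.
have mS (x y : R) (i j : bool) : 0 < x -> y < 1 ->
    measurable_fun ([set` Interval (BSide i x) (BSide j y)] : set (measurableTypeR R)) (fun t => (h t)%:E).
  move=> x0 y1; apply/measurable_EFinP.
  by apply: measurable_funS mh; [exact: mU|exact: subU].
rewrite -integral_itv_obnd_cbnd in i2; last exact: mS.
have i3 : (\int[mu]_(t in `[s, 2^-1%R]) (h t)%:E + \int[mu]_(t in `]2^-1%R, (1 - s)%R]) (h t)%:E <=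
    \int[mu]_(t in U) (h t)%:E)%E.
  have mA : measurable (`[s, 2^-1]%classic : set (measurableTypeR R)) by exact: measurable_itv.
  have mB : measurable (`]2^-1, 1 - s]%classic : set (measurableTypeR R)) by exact: measurable_itv.
  have mAB : measurable_fun ((`[s, 2^-1]%classic : set (measurableTypeR R)) `|` `]2^-1, 1 - s]%classic)
      (fun t => (h t)%:E).
    rewrite -(@itv_bndbnd_setU _ _ _ (BRight (2^-1 : R))) ?bnd_simp//; last by lra.
    exact: mS.
  have hAB t : ((`[s, 2^-1]%classic : set (measurableTypeR R)) `|` `]2^-1, 1 - s]%classic) t ->
      (0 <= (h t)%:E)%E.
    by move=> [|]; rewrite /= in_itv /= => /andP[? ?]; rewrite lee_fin h0//; apply/andP; split; lra.
  have dAB : [disjoint (`[s, 2^-1]%classic : set (measurableTypeR R)) & `]2^-1, 1 - s]%classic].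
    rewrite disj_set2E; apply/eqP; rewrite -subset0 => w [] /=.
    by rewrite !in_itv /= => /andP[_ wy] /andP[/lt_le_trans/(_ wy)]; rewrite ltxx.
  rewrite -(ge0_integral_setU mu mA mB mAB hAB dAB).
  apply: ge0_subset_integral => //; try exact: mU.
  - exact: measurableU.
  - exact/measurable_EFinP.
  - by move=> t [|]; apply: subU.
have := le_trans (leeD i1 i2) (le_trans i3 hX).
by rewrite -EFinD lee_fin; lra.
Qed.

(** For [s <= t <= 1/2], the points [t] and [1 - t] are combinations of [s] and [1 - s] with
    interchanged weights, so by convexity [g t + g (1 - t) <= g s + g (1 - s)]. *)
Lemma convex_smono g : unit_convex g -> smono (fun t => (-1) * (g t + g (1 - t))).
Proof.
move=> cg; split=> [t tI|s t s0 st th].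
  by rewrite opprB addrCA subrr addr0 [g t + _]addrC.
have [sh|sh] := eqVneq s 2^-1; first by have -> : t = s by lra.
have sh' : 0 < 1 - 2 * s by rewrite subr_gt0 mulrC -ltr_pdivlMr// div1r lt_neqAle sh; lra.
have [l l1 lE] : exists2 l, 0 <= l <= 1 & l * (1 - 2 * s) = t - s.
  exists ((t - s) / (1 - 2 * s)); last by rewrite divfK ?gt_eqF.
  apply/andP; split; first by apply: divr_ge0; [rewrite subr_ge0|exact: ltW].
  by rewrite ler_pdivrMr// mul1r; lra.
have /andP[l0 l1'] := l1.
have sI : s \in `[0%R, 1%R] by rewrite in_itv /=; apply/andP; split; lra.
have s1I : 1 - s \in `[0%R, 1%R] by rewrite in_itv /=; apply/andP; split; lra.
have lI : l \in `[0%R, 1%R] by rewrite in_itv.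
have h1 := cg _ _ _ sI s1I lI; have h2 := cg _ _ _ s1I sI lI.
have e1 : (1 - l) * s + l * (1 - s) = t by rewrite -[RHS](subrK s) -lE; ring.
have e2 : (1 - l) * (1 - s) + l * s = 1 - t by rewrite -[t](subrK s) -lE; ring.
by rewrite e1 in h1; rewrite e2 in h2; lra.
Qed.

(** The left side is the increment of [g] over [[1/2, 1 - s]], with slope at most [d 1], minus that
    over [[s, 1/2]], with slope at least [d 0]; both lengths are [1/2 - s]. *)
Lemma convex_osc g d : unit_convex g ->
  (forall t, t \in `[0, 1] -> unit_slope g t (d t)) ->
  forall s, 0 < s -> s <= 2^-1 ->
  (-1) * (g 2^-1 + g (1 - 2^-1)) - (-1) * (g s + g (1 - s)) <= 2^-1 * (d 1 - d 0).
Proof.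
move=> cg hg s s0 sh.
have I0 : 0 \in `[0%R, 1%R :> R] by rewrite in_itv /= lexx ler01.
have I1 : 1 \in `[0%R, 1%R :> R] by rewrite in_itv /= lexx ler01.
have d01 := convex_slope_nondecreasing cg hg I0 I1 ler01.
have sI : s \in `[0%R, 1%R] by rewrite in_itv /=; apply/andP; split; lra.
have s1I : 1 - s \in `[0%R, 1%R] by rewrite in_itv /=; apply/andP; split; lra.
have hI : 2^-1 \in `[0%R, 1%R :> R] by rewrite in_itv /=; apply/andP; split; lra.
have /andP[h1 _] := convex_increment cg hg sI hI sh.
have /andP[_ h2] := convex_increment cg hg hI s1I ltac:(lra).
have -> : 1 - 2^-1 = 2^-1 :> R by lra.
have h3 : 0 <= (d 1 - d 0) * s by rewrite mulr_ge0 ?subr_ge0// ltW.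
by lra.
Qed.

Lemma convex_slope_bound g d h :
  (forall t, t \in `[0, 1] -> unit_slope g t (d t)) ->
  (forall t, 0 < t < 1 -> `|d (1 - t) - d t| <= h t) ->
  slope_bound (fun t => (-1) * (g t + g (1 - t))) h.
Proof.
move=> hg hh t c tI hc; have [t0 t1] := andP tI.
(* The slack between [h t] and [c] is shared by the two first-order errors, at [t] and at [1 - t];
   the linear part has slope [d (1 - t) - d t]. *)
pose e := (c - h t) / 2; have e0 : 0 < e by rewrite divr_gt0// subr_gt0.
have [|r r0 hr] := hg t _ e e0; first by rewrite in_itv /=; apply/andP; split; lra.
have [|r' r'0 hr'] := hg (1 - t) _ e e0; first by rewrite in_itv /=; apply/andP; split; lra.
exists (Num.min r r'); first by rewrite lt_min r0.
move=> s /andP[s0 s1]; rewrite lt_min => /andP[sr sr'].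
have h1 := hr s ltac:(by rewrite in_itv /=; apply/andP; split; lra) sr.
have E : 1 - s - (1 - t) = - (s - t) by ring.
have := hr' (1 - s) ltac:(by rewrite in_itv /=; apply/andP; split; lra).
rewrite E normrN => /(_ sr') h2.
have -> : (-1) * (g s + g (1 - s)) - (-1) * (g t + g (1 - t)) =
   - (g s - g t - d t * (s - t)) - (g (1 - s) - g (1 - t) - d (1 - t) * (- (s - t)))
   + (d (1 - t) - d t) * (s - t) by ring.
apply: le_trans (ler_normD _ _) _.
have h3 : `|(d (1 - t) - d t) * (s - t)| <= h t * `|s - t|.
  by rewrite normrM ler_wpM2r ?hh.
apply: le_trans (lerD (ler_normB _ _) h3) _; rewrite normrN.
apply: le_trans (lerD (lerD h1 h2) (lexx _)) _.
by rewrite -!mulrDl ler_wpM2r// /e; lra.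
Qed.

Lemma derivable_slope_bound p : (forall t, t \in `]0%R, 1%R[ -> derivable p t 1) ->
  slope_bound p (fun t => `|derive1 p t|).
Proof.
move=> dp t c tI hc; have tI' : t \in `]0%R, 1%R[ by rewrite in_itv.
have := dp _ tI'; rewrite /derivable => /cvg_ex[l hl].
have lE : derive1 p t = l by rewrite derive1E; exact: cvg_lim.
rewrite lE in hc.
have e0 : 0 < c - `|l| by rewrite subr_gt0.
move/cvgrPdist_lt: hl => /(_ _ e0); rewrite near_withinE => -[r /= r0 hr].
exists r => // s _ st; have [->|st0] := eqVneq s t; first by rewrite !subrr normr0 mulr0.
have k0 : s - t != 0 by rewrite subr_eq0.
have := hr (s - t); rewrite /= sub0r normrN => /(_ st k0).
rewrite [(s - t) *: 1]mulr1 subrK => hn.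
have stp : 0 < `|s - t| by rewrite normr_gt0.
have -> : p s - p t = (l - (l - (s - t)^-1 *: (p s - p t))) * (s - t).
  by rewrite /GRing.scale /=; field.
rewrite normrM ler_wpM2r//; apply: le_trans (ler_normB _ _) _.
by move: (ltW hn); lra.
Qed.

(** The bound on [p'] is uniform, so the mean value theorem on [[s, 1/2]] suffices; the factor [1/2]
    is the length of the half interval. *)
Lemma derivable_osc p (M : R) : (forall t, t \in `]0%R, 1%R[ -> derivable p t 1) ->
  (forall t, 0 < t < 1 -> `|derive1 p t| <= M) ->
  forall s, 0 < s -> s <= 2^-1 -> p 2^-1 - p s <= 2^-1 * M.
Proof.
move=> dp hM s s0 sh.
have M0 : 0 <= M by apply: le_trans (hM 2^-1 _); [exact: normr_ge0|apply/andP; split; lra].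
move: sh; rewrite le_eqVlt => /predU1P[->|sh]; first by rewrite subrr mulr_ge0// invr_ge0.
have [||c] := @MVT R p (derive1 p) s 2^-1 sh.
- move=> x; rewrite in_itv /= => /andP[x0 x1].
  have /dp dx : x \in `]0%R, 1%R[ by rewrite in_itv /=; apply/andP; split; lra.
  by rewrite derive1E; exact: derivableP.
- apply: derivable_within_continuous => x; rewrite in_itv /= => /andP[x0 x1].
  by apply: dp; rewrite in_itv /=; apply/andP; split; lra.
rewrite in_itv /= => /andP[c0 c1] ->.
have := hM c ltac:(by apply/andP; split; lra); rewrite ler_norml => /andP[_ h].
have hs : 0 <= 2^-1 - s by lra.
have := ler_wpM2r hs h.
by have := mulr_ge0 M0 (ltW s0); lra.
Qed.

End Oscillation.

(** * The scalar inequality for a symmetric weight and a convex function *)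

Section Core.
Context {R : realType}.
Context (p g : R -> R) (bp : bmf p) (bg : bmf g) (sp : smono p) (cg : unit_convex g).

Let w t := (-1) * (g t + g (1 - t)).

(* Reflecting t to 1 - t replaces g (1 - t) by its symmetrization - w / 2. *)
Lemma cov_symmetrized : J p * J (fun t => g (1 - t)) - J (fun t => p t * g (1 - t)) =
  2^-1 * (J (fun t => p t * w t) - J p * J w).
Proof.
have bg1 := bmf_onem bg.
have Jw : J w = (-1) * (J g + J (fun t => g (1 - t))).
  by rewrite /w JZ; [rewrite JD|]; bmf_tac.
have Jpw : J (fun t => p t * w t) =
    (-1) * (J (fun t => p t * g t) + J (fun t => p t * g (1 - t))).
  rewrite -JD; bmf_tac; rewrite -JZ; bmf_tac.
  by apply: J_eq => t _; rewrite /w; ring.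
have Jg : J (fun t => g (1 - t)) = J g by exact: J_onem.
have Jpg : J (fun t => p t * g (1 - t)) = J (fun t => p t * g t).
  rewrite -(J_onem (u := fun t => p t * g t)); bmf_tac.
  by apply: J_eq => t /sp.1 ->.
by rewrite Jw Jpw Jg Jpg; field.
Qed.

Let bw : bmf w.
Proof. by rewrite /w; have := bmf_onem bg => bg1; bmf_tac. Qed.

Lemma cov_ge0 : 0 <= J p * J (fun t => g (1 - t)) - J (fun t => p t * g (1 - t)).
Proof.
rewrite cov_symmetrized mulr_ge0 ?invr_ge0// subr_ge0.
apply: chebyshev => // s t sI tI.
by apply: smono_comonotone => //; exact: convex_smono.
Qed.

(** The [8] is the [2] of [cov_symmetrized] times the [4] of [gruss]. *)
Lemma cov_le P Q :
  (forall s, 0 < s -> s <= 2^-1 -> p 2^-1 - p s <= P) ->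
  (forall s, 0 < s -> s <= 2^-1 -> w 2^-1 - w s <= Q) ->
  J p * J (fun t => g (1 - t)) - J (fun t => p t * g (1 - t)) <= P * Q / 8.
Proof.
move=> hP hQ; rewrite cov_symmetrized.
have := gruss bp bw (smono_osc sp hP) (smono_osc (convex_smono cg) hQ).
by lra.
Qed.

End Core.

(** * Bochner integrals *)

Section SimpleFunctions.
Context {R : realType} {H : hilbertType R}.
Implicit Types (x y : H) (s : op_simple H) (t c : R) (u : R -> R).
Local Notation mu := (@lebesgue_measure R).
Local Notation U := (`]0%R, 1%R[%classic : set (measurableTypeR R)).
Local Notation I01 := (`[0%R, 1%R]%classic : set (measurableTypeR R)).

Lemma bounded_op_simple_fun s t : bounded_op (simple_fun s t).
Proof.
by apply: bounded_op_sum => i _; apply: bounded_opZ; exact: simple_val_bounded.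
Qed.

Lemma bounded_op_simple_integral s : bounded_op (simple_integral s).
Proof.
by apply: bounded_op_sum => i _; apply: bounded_opZ; exact: simple_val_bounded.
Qed.

Lemma bmf_sum (T : Type) (r : seq T) (u : T -> R -> R) : (forall i, bmf (u i)) ->
  bmf (fun t => \sum_(i <- r) u i t).
Proof.
move=> hu; elim: r => [|a r IH].
  by under eq_fun do rewrite big_nil; exact: bmf_cst.
by under eq_fun do rewrite big_cons; exact: bmfD.
Qed.

Lemma J_sum (T : Type) (r : seq T) (u : T -> R -> R) : (forall i, bmf (u i)) ->
  J (fun t => \sum_(i <- r) u i t) = \sum_(i <- r) J (u i).
Proof.
move=> hu; elim: r => [|a r IH].
  by under eq_fun do rewrite big_nil; rewrite big_nil J_cst.
under eq_fun do rewrite big_cons.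
by rewrite big_cons JD// ?IH//; exact: bmf_sum.
Qed.

Lemma bmf_indic (A : set (measurableTypeR R)) : measurable A -> bmf \1_A.
Proof.
move=> mA; split; first exact: measurable_indic.
by exists 1 => // t _; rewrite indicE; case: (_ \in _); rewrite ?normr1 ?normr0.
Qed.

Lemma J_indic (A : set (measurableTypeR R)) : measurable A -> A `<=` I01 ->
  J \1_A = fine (mu A).
Proof.
move=> mA AI; rewrite -J_Rintegral_cc; last exact: bmf_indic.
rewrite /Rintegral integral_indic//.
by rewrite setIidl.
Qed.

Lemma rdot_simple_fun s t x y : rdot (simple_fun s t x) y =
  \sum_i rdot (@simple_val _ _ s i x) y * \1_(@simple_set _ _ s i) t.
Proof.
rewrite /simple_fun sumopE rdot_suml; apply: eq_bigr => i _.
by rewrite opE rdotZl mulrC.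
Qed.

Lemma bmf_simple_fun s x y : bmf (fun t => rdot (simple_fun s t x) y).
Proof.
have -> : (fun t => rdot (simple_fun s t x) y) = fun t =>
    \sum_i rdot (@simple_val _ _ s i x) y * \1_(@simple_set _ _ s i) t.
  by apply/funext => t; exact: rdot_simple_fun.
apply: bmf_sum => i; apply: bmfZ; apply: bmf_indic.
exact: simple_set_measurable.
Qed.

Lemma J_simple_fun s x y :
  J (fun t => rdot (simple_fun s t x) y) = rdot (simple_integral s x) y.
Proof.
have -> : (fun t => rdot (simple_fun s t x) y) = fun t =>
    \sum_i rdot (@simple_val _ _ s i x) y * \1_(@simple_set _ _ s i) t.
  by apply/funext => t; exact: rdot_simple_fun.
have bi i : bmf (\1_(@simple_set _ _ s i)).
  by apply: bmf_indic; exact: simple_set_measurable.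
rewrite J_sum; last by move=> i; exact: bmfZ.
rewrite /simple_integral sumopE rdot_suml; apply: eq_bigr => i _.
rewrite JZ// J_indic; last 2 first.
  exact: simple_set_measurable.
  exact: simple_set_sub.
by rewrite opE rdotZl mulrC.
Qed.

Lemma measurable_finlabel (T : finType) (b : R -> T) (c : T -> R) :
  (forall k, measurable ([set t | b t = k] : set (measurableTypeR R))) ->
  measurable_fun [set: measurableTypeR R] (fun t => c (b t)).
Proof.
move=> mb.
have -> : (fun t => c (b t)) = fun t => \sum_(k : T) c k * \1_([set t | b t = k]) t.
  apply/funext => t; rewrite (bigD1 (b t))//= big1 ?addr0 => [|k kb].
    by rewrite indicE mem_set// mulr1.
  by rewrite indicE memNset ?mulr0//= => bk; move: kb; rewrite bk eqxx.
apply: measurable_sum => k; apply: measurable_funM => //; exact: measurable_indic.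
Qed.

(** The sets of a simple function may overlap, so its value depends on the whole membership pattern
    of [t]. There are finitely many patterns, each on a measurable set, so any function of the
    value, such as a norm, is measurable in [t]. *)
Let bits s t : {ffun 'I_(simple_size s) -> bool} := [ffun i => t \in @simple_set _ _ s i].

Let bval s (b : {ffun 'I_(simple_size s) -> bool}) : H -> H :=
  \sum_i ((b i)%:R)%:C *: @simple_val _ _ s i.

Let simple_fun_bits s t : simple_fun s t = bval (bits s t).
Proof. by apply: eq_bigr => i _; rewrite indicE ffunE. Qed.

Let measurable_bits s (k : {ffun 'I_(simple_size s) -> bool}) :
  measurable ([set t | bits s t = k] : set (measurableTypeR R)).
Proof.
have -> : [set t | bits s t = k] = \bigcap_(i in [set: 'I_(simple_size s)])
    (if k i then @simple_set _ _ s i else ~` @simple_set _ _ s i).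
  apply/seteqP; split=> [t /= <- i _|t h].
    by rewrite ffunE; case: ifPn; [rewrite inE|rewrite notin_setE].
  apply/ffunP => i; rewrite ffunE; have := h i I.
  by case: (k i) => [/mem_set//|/= nt]; apply/negbTE; rewrite notin_setE.
apply: fin_bigcap_measurable => // i _; case: (k i).
  exact: simple_set_measurable.
by apply: measurableC; exact: simple_set_measurable.
Qed.

Lemma measurable_opnorm_simple s s' :
  measurable_fun [set: measurableTypeR R] (fun t => opnorm (simple_fun s t - simple_fun s' t)).
Proof.
have -> : (fun t => opnorm (simple_fun s t - simple_fun s' t)) = (fun t =>
    (fun k => opnorm (bval k.1 - bval k.2)) (bits s t, bits s' t)).
  by apply/funext => t /=; rewrite !simple_fun_bits.
apply: (@measurable_finlabel _ (fun t => (bits s t, bits s' t))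
  (fun k => opnorm (bval k.1 - bval k.2))) => -[k k'].
have -> : [set t | (bits s t, bits s' t) = (k, k')] =
    [set t | bits s t = k] `&` [set t | bits s' t = k'].
  by apply/seteqP; split=> t /= [-> ->].
exact: measurableI.
Qed.

End SimpleFunctions.

Section OpIntegral.
Context {R : realType} {H : hilbertType R}.
Implicit Types (x y : H) (s : op_simple H) (t c : R) (K : R -> H -> H) (V : H -> H).
Local Notation mu := (@lebesgue_measure R).
Local Notation U := (`]0%R, 1%R[%classic : set (measurableTypeR R)).
Local Notation I01 := (`[0%R, 1%R]%classic : set (measurableTypeR R)).

(** The identity is exact for simple functions. Passing to [K] and [V] costs at most [|x| |y|] times
    the approximation errors of the integral and of its value, both tending to [0]. *)
Lemma op_integral_rdot K V x y : is_op_integral K V ->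
  bmf (fun t => rdot (K t x) y) -> rdot (V x) y = J (fun t => rdot (K t x) y).
Proof.
move=> [bV bK [s [ms cs csV]]] bKxy; apply/eqP; rewrite -subr_eq0 -normr_le0.
apply/ler_addgt0Pl => e e0; rewrite addr0.
pose k := nm x * nm y; have k0 : 0 <= k by rewrite mulr_ge0 ?nm_ge0.
have k1 : 0 < 2 * (k + 1) by lra.
pose d := e / (2 * (k + 1)); have d0 : 0 < d by rewrite divr_gt0.
have hk : k * d <= e / 2.
  have -> : e / 2 = (k + 1) * d by rewrite /d; field; lra.
  by rewrite ler_wpM2r ?(ltW d0)//; lra.
have /fine_cvgP[[N1 _ hfin] /cvgrPdist_lt/(_ _ d0)[N2 _ h2]] := cs.
have /cvgrPdist_lt/(_ _ d0)[N3 _ h3] := csV.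
pose n := maxn N1 (maxn N2 N3).
have {hfin} Xfin := hfin n (leq_maxl _ _).
have {h2} := h2 n; rewrite /= => /(_ ltac:(by rewrite /n /= !leq_max leqnn !orbT)).
have {h3} := h3 n; rewrite /= => /(_ ltac:(by rewrite /n /= !leq_max leqnn !orbT)).
rewrite !sub0r !normrN.
have bVn := bounded_opB bV (bounded_op_simple_integral (s n)).
rewrite (ger0_norm (opnorm_ge0 bVn)) => h3 h2.
have bsn := bmf_simple_fun (s n) x y.
have -> : rdot (V x) y - J (fun t => rdot (K t x) y) =
  rdot ((V - simple_integral (s n)) x) y +
  J (fun t => rdot (simple_fun (s n) t x) y + (-1) * rdot (K t x) y).
  by rewrite JD ?JZ ?J_simple_fun//; [rewrite opE rdotBl; ring|exact: bmfZ].
apply: le_trans (ler_normD _ _) _; rewrite [leRHS]splitr; apply: lerD.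
  apply: le_trans (rdot_abs_le _ _) _; apply: le_trans hk.
  rewrite /k -mulrA (mulrC (nm y)) mulrA ler_wpM2r ?nm_ge0//.
  apply: le_trans (opnormP bVn x) _; rewrite (mulrC (nm x)).
  by rewrite ler_wpM2r ?nm_ge0// ltW.
pose D t := rdot (simple_fun (s n) t x) y + (-1) * rdot (K t x) y.
have bD : bmf D by apply: bmfD => //; exact: bmfZ.
rewrite -/(J D).
have bnD : bmf (fun t => `|D t|).
  have [mD [C C0 hC]] := bD; split; last by exists C => // t; rewrite normr_id; exact: hC.
  exact: measurableT_comp.
apply: (@le_trans _ _ (J (fun t => `|D t|))).
  rewrite ler_norml -[- J _]mulN1r -JZ//; apply/andP; split; apply: J_le => //.
  - exact: bmfZ.
  - move=> t _ /=; rewrite -/(D t); move: (D t) => q.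
    have := ler_norm (- q); rewrite normrN => hq.
    by lra.
  - by move=> t _; exact: ler_norm.
apply: le_trans hk.
set X := (\int[mu]_(t in `[0%R, 1%R]) _)%E in Xfin h2.
have X0 : (0 <= X)%E.
  apply: integral_ge0 => t tI; rewrite lee_fin opnorm_ge0//.
  by apply: bounded_opB; [exact: bK|exact: bounded_op_simple_fun].
rewrite ger0_norm in h2; last exact: fine_ge0.
apply: (@le_trans _ _ (k * fine X)); last by rewrite ler_wpM2l// ltW.
rewrite -lee_fin EFinM (fineK Xfin).
rewrite /J /Rintegral fineK; last first.
  by have /integrable_fin_num := bmf_integrable bnD; apply; exact: mU.
have mX : measurable_fun I01 (fun t => (opnorm (K t - simple_fun (s n) t))%:E).
  by apply/measurable_EFinP; exact: ms.
have pX t : I01 t -> (0 <= (opnorm (K t - simple_fun (s n) t))%:E)%E.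
  move=> tI; rewrite lee_fin opnorm_ge0//.
  by apply: bounded_opB; [exact: bK|exact: bounded_op_simple_fun].
have UI : U `<=` I01 by move=> t; rewrite /= !in_itv /= => /andP[/ltW-> /ltW->].
apply: (@le_trans _ _ (\int[mu]_(t in U) (k%:E * (opnorm (K t - simple_fun (s n) t))%:E))%E).
  apply: ge0_le_integral => //; try exact: mU.
  - by apply/measurable_EFinP; case: bnD.
  - by apply: measurable_funeM; apply: measurable_funS mX => //; exact: measurable_itv.
  - move=> t tU; rewrite -EFinM lee_fin /D mulN1r -rdotBl.
    have bKt : bounded_op (K t - simple_fun (s n) t).
      by apply: bounded_opB; [exact/bK/UI|exact: bounded_op_simple_fun].
    apply: le_trans (rdot_abs_le _ _) _.
    rewrite nm_sub -opE /k mulrAC ler_wpM2r ?nm_ge0//.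
    by rewrite mulrC; exact: opnormP.
rewrite ge0_integralZl//; try exact: mU; last 2 first.
  by apply: measurable_funS mX => //; exact: measurable_itv.
  by move=> t /UI; exact: pX.
rewrite lee_wpmul2l ?lee_fin//.
by apply: ge0_subset_integral.
Qed.

(** Completeness of the bounded operators with a rate: pointwise limits exist in [H], and letting
    [m] tend to infinity leaves the error [e n]. *)
Lemma bounded_op_complete (S : nat -> H -> H) (e : nat -> R) :
  (forall n, bounded_op (S n)) -> e @ \oo --> (0 : R) ->
  (forall n m x, nm ((S n - S m) x) <= (e n + e m) * nm x) ->
  exists2 V, bounded_op V & forall n x, nm ((V - S n) x) <= e n * nm x.
Proof.
move=> bS ce hS.
have e0 r : 0 < r -> exists N, forall n, (N <= n)%N -> `|e n| < r.
  move=> r0; move/cvgrPdist_lt: ce => /(_ _ r0)[N _ hN].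
  by exists N => n /hN; rewrite /= sub0r normrN.
have small x r : 0 < r -> exists N, forall n, (N <= n)%N -> `|e n| * nm x < r.
  move=> r0; have x1 : 0 < nm x + 1 by rewrite ltr_wpDl ?nm_ge0.
  have [|N hN] := e0 (r / (nm x + 1)); first by rewrite divr_gt0.
  exists N => n /hN; rewrite ltr_pdivlMr//; apply: le_lt_trans.
  by rewrite ler_wpM2l// lerDl.
have cv x : cvgn (fun n => S n x).
  apply: nm_cauchy_cvg => r r0; have r2 : 0 < r / 2 by rewrite divr_gt0.
  have [N hN] := small x _ r2; exists N => // n /= Nn m nm'.
  rewrite -opE; apply: le_lt_trans (hS _ _ _) _.
  rewrite mulrDl [ltRHS]splitr; apply: ltrD.
    by apply: le_lt_trans (hN n Nn); rewrite ler_wpM2r ?nm_ge0 ?ler_norm.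
  by apply: le_lt_trans (hN m (leq_trans Nn nm')); rewrite ler_wpM2r ?nm_ge0 ?ler_norm.
pose V x := limn (fun n => S n x).
have hV n x : nm ((V - S n) x) <= e n * nm x.
  apply/ler_addgt0Pl => r r0; have r2 : 0 < r / 2 by rewrite divr_gt0.
  have [N1 hN1] := small x _ r2.
  have /cvg_nm/(_ _ r2)[N2 _ hN2] := cv x.
  pose m := maxn N1 N2.
  rewrite !opE -[V x](subrK (S m x)) -addrA.
  apply: le_trans (nmD _ _) _.
  have h1 := hN2 m (leq_maxr _ _); have h2 := hN1 m (leq_maxl _ _).
  have := hS m n x; rewrite opE mulrDl => h3.
  have h4 : e m * nm x <= `|e m| * nm x by rewrite ler_wpM2r ?nm_ge0 ?ler_norm.
  rewrite /= in h1; rewrite [r]splitr.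
  apply: le_trans (lerD (ltW h1) h3) _; lra.
exists V => //; have [N hN] := e0 _ ltr01.
have [_ [k k0 hk]] := (bounded_opP _).1 (bS N).
apply/bounded_opP; split=> [a x y|]; last first.
  exists (1 + k) => [|x]; first by rewrite addr_ge0.
  rewrite -[V x](subrK (S N x)); apply: le_trans (nmD _ _) _.
  rewrite mulrDl lerD//; apply: le_trans (hV N x) _.
  by rewrite ler_wpM2r ?nm_ge0// (le_trans (ler_norm _))// ltW// hN.
apply/eqP; rewrite -subr_eq0; apply/eqP/nm_eq0/eqP; rewrite eq_le nm_ge0 andbT.
apply/ler_addgt0Pl => r r0; rewrite addr0.
(* The defect of linearity of [V] is at most [e M] times the first three terms, for every [M]; the
   final [1] makes [q] positive. *)
pose q := complex.Re `|a| * nm x + nm y + nm (a *: x + y) + 1.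
have aE : `|a| = (complex.Re `|a|)%:C by rewrite RRe_real// normr_real.
have a0 : 0 <= complex.Re `|a| by rewrite -ler0c -aE.
have q0 : 0 < q by rewrite /q ltr_wpDl// !addr_ge0 ?mulr_ge0 ?nm_ge0.
have [|M hM] := e0 (r / q); first by rewrite divr_gt0.
have := hM M (leqnn _); rewrite ltr_pdivlMr// => hr.
have lS := (bS M).1.
have nmaZ z : nm (a *: z) = complex.Re `|a| * nm z.
  by apply: complexI; rewrite -normE normrZ aE normE rmorphM.
have -> : V (a *: x + y) - (a *: V x + V y) =
   (V - S M) (a *: x + y) - (a *: (V - S M) x + (V - S M) y).
  by rewrite !opE lS scalerBr addrACA -opprD opprB addrA subrK.
apply: le_trans (nmD _ _) _; rewrite nmN.
apply: le_trans (lerD (lexx _) (nmD _ _)) _; rewrite nmaZ.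
have h1 := hV M (a *: x + y); have h2 := ler_wpM2l a0 (hV M x); have h3 := hV M y.
apply: le_trans (lerD h1 (lerD h2 h3)) _; apply: le_trans (ltW hr).
have q1 : 0 <= q - 1 by rewrite /q addrK !addr_ge0 ?mulr_ge0 ?nm_ge0.
apply: (@le_trans _ _ (e M * (q - 1))); first by rewrite /q; lra.
apply: le_trans (ler_wpM2r q1 (ler_norm _)) _.
by rewrite ler_wpM2l// gerBl.
Qed.

End OpIntegral.

(** * Existence of the integral of a measurable weight times a Lipschitz path *)

Section Existence.
Context {R : realType} {H : hilbertType R}.
Implicit Types (x y : H) (s : op_simple H) (t c : R) (K : R -> H -> H) (V : H -> H).
Local Notation mu := (@lebesgue_measure R).
Local Notation U := (`]0%R, 1%R[%classic : set (measurableTypeR R)).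
Local Notation I01 := (`[0%R, 1%R]%classic : set (measurableTypeR R)).

(** Uniform approximation makes the simple integrals a Cauchy sequence in operator norm, and [V] is
    their limit. *)
Lemma op_integral_uniform_limit K (s : nat -> op_simple H) (e : nat -> R) :
  (forall t, t \in `[0%R, 1%R] -> bounded_op (K t)) ->
  e @ \oo --> (0 : R) -> (forall n, 0 <= e n) ->
  (forall n t x, t \in `[0%R, 1%R] -> nm ((K t - simple_fun (s n) t) x) <= e n * nm x) ->
  exists V, is_op_integral K V.
Proof.
move=> bK ce e0 hs.
have bs n t : bounded_op (simple_fun (s n) t) by exact: bounded_op_simple_fun.
have ono n t : t \in `[0%R, 1%R] -> opnorm (K t - simple_fun (s n) t) <= e n.
  by move=> tI; apply: opnorm_le => // x; exact: hs.
have hI n m x : nm ((simple_integral (s n) - simple_integral (s m)) x) <= (e n + e m) * nm x.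
  set T := simple_integral (s n) - _; have [->|/eqP Tx] := eqVneq (nm (T x)) 0.
    by rewrite mulr_ge0 ?addr_ge0 ?nm_ge0.
  have Tp : 0 < nm (T x) by rewrite lt_def nm_ge0 andbT; exact/eqP.
  (* Pairing [T x] with itself reduces its norm to a scalar integral; one factor [|T x|] then
     cancels. *)
  rewrite -(ler_pM2r Tp) -expr2 -rdotxx {1}/T opE rdotBl -!J_simple_fun.
  rewrite -mulN1r -JZ; last exact: bmf_simple_fun.
  rewrite -JD; last 2 first.
  - exact: bmf_simple_fun.
  - by apply: bmfZ; exact: bmf_simple_fun.
  rewrite -[leRHS](J_cst); apply: J_le.
  - by apply: bmfD; [|apply: bmfZ]; exact: bmf_simple_fun.
  - exact: bmf_cst.
  move=> t /andP[t0 t1]; rewrite mulN1r -rdotBl.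
  have tI : t \in `[0%R, 1%R] by rewrite in_itv /= !ltW.
  apply: le_trans (rdot_le _ _) _; rewrite ler_wpM2r ?nm_ge0//.
  have -> : simple_fun (s n) t x - simple_fun (s m) t x =
      (K t - simple_fun (s m) t) x - (K t - simple_fun (s n) t) x.
    by rewrite !opE opprB [RHS]addrC addrA subrK.
  apply: le_trans (nmD _ _) _; rewrite nmN mulrDl addrC.
  by apply: lerD; exact: hs.
have [V bV hV] := bounded_op_complete (fun n => bounded_op_simple_integral (s n)) ce hI.
exists V; split=> //; exists s.
have ms n : measurable_fun I01 (fun t => opnorm (K t - simple_fun (s n) t)).
  (* The norm of [K t - simple_fun (s n) t] is the pointwise limit in [m] of norms of differences of
     two simple functions, which are measurable. *)
  apply: (@measurable_fun_cvg _ _ _ _ (fun m t => opnorm (simple_fun (s m) t - simple_fun (s n) t))).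
    by move=> m; apply: measurable_funTS; exact: measurable_opnorm_simple.
  move=> t tI; have {}tI : t \in `[0%R, 1%R] by [].
  apply/cvgrPdist_le => r r0; move/cvgrPdist_le: ce => /(_ _ r0); apply: filterS => m.
  rewrite sub0r normrN (ger0_norm (e0 m)) => em.
  have h1 := opnorm_dist (bK t tI) (bs m t) (bs n t).
  have h2 := opnorm_dist (bs m t) (bK t tI) (bs n t).
  have h3 : opnorm (simple_fun (s m) t - K t) <= e m.
    by apply: opnorm_le => // x; rewrite opE nm_sub -opE; exact: hs.
  have h4 := ono m t tI.
  by rewrite ler_norml; apply/andP; split; lra.
have X0 n : (0 <= \int[mu]_(t in I01) (opnorm (K t - simple_fun (s n) t))%:E)%E.
  apply: integral_ge0 => t tI; rewrite lee_fin opnorm_ge0//.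
  by apply: bounded_opB => //; exact: bK.
have Xe n : (\int[mu]_(t in I01) (opnorm (K t - simple_fun (s n) t))%:E <= (e n)%:E)%E.
  have -> : ((e n)%:E = \int[mu]_(t in I01) (e n)%:E)%E.
    rewrite integral_cst//= lebesgue_measure_itv /= lte_fin ltr01 oppr0 adde0.
    by rewrite mule1.
  apply: ge0_le_integral => //.
  - by move=> t tI; rewrite lee_fin opnorm_ge0//; apply: bounded_opB => //; exact: bK.
  - by apply/measurable_EFinP; exact: ms.
  - by move=> t tI; rewrite lee_fin; exact: ono.
split=> //.
- apply/fine_cvgP; split.
    apply: nearW => n; rewrite ge0_fin_numE//; exact: le_lt_trans (Xe n) (ltry _).
  apply/cvgrPdist_le => r r0; move/cvgrPdist_le: ce => /(_ _ r0); apply: filterS => m.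
  rewrite !sub0r !normrN (ger0_norm (e0 m)) => em; rewrite ger0_norm; last exact: fine_ge0.
  apply: le_trans em; rewrite -lee_fin fineK// ge0_fin_numE//.
  exact: le_lt_trans (Xe m) (ltry _).
- apply/cvgrPdist_le => r r0; move/cvgrPdist_le: ce => /(_ _ r0); apply: filterS => m.
  rewrite !sub0r !normrN (ger0_norm (e0 m)) => em; rewrite ger0_norm.
    by apply: le_trans em; apply: opnorm_le => // x; exact: hV.
  by apply: opnorm_ge0; apply: bounded_opB => //; exact: bounded_op_simple_integral.
Qed.

Section grid.
Context (w : R -> R) (F : R -> H -> H) (C B L : R).
Hypothesis mw : measurable_fun I01 w.
Hypothesis wC : forall t, t \in `[0%R, 1%R] -> `|w t| <= C.
Hypothesis bF : forall t, t \in `[0%R, 1%R] -> bounded_op (F t).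
Hypothesis FB : forall t x, t \in `[0%R, 1%R] -> nm (F t x) <= B * nm x.
Hypothesis FL : forall (s t : R) (x : H), s \in `[0%R, 1%R] -> t \in `[0%R, 1%R] ->
  nm ((F t - F s) x) <= L * `|t - s| * nm x.

Let C0 : 0 <= C.
Proof. by apply: le_trans (wC (t := 0) _); rewrite ?in_itv /= ?lexx ?ler01. Qed.

Hypothesis L0 : 0 <= L.

Variable n : nat.
Let m : R := n.+1%:R.
(** [M] counts the integer parts of [m (w t + C)], which ranges over [[0, 2 m C]]. In [N], the
    factor [n.+2] counts those of [m t], which reaches [n + 1] at [t = 1]. *)
Let M := (Num.trunc (m * (C + C))).+1.
Let N := (n.+2 * M)%N.

Let m0 : 0 < m. Proof. by rewrite ltr0n. Qed.

(** The index codes a pair: [k %/ M] is the slice of [t], [k %% M] the slice of [w t + C], both of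
    width [1 / m]. The weight [w] is only measurable, so it is sliced by its values. *)
Let cell (k : 'I_N) : set R := I01 `&`
  ((fun t => m * t) @^-1` `[(k %/ M)%:R, (k %/ M).+1%:R[ `&`
   (fun t => m * (w t + C)) @^-1` `[(k %% M)%:R, (k %% M).+1%:R[).

(** A point of the cell certifies that the node [(k %/ M) / m] is in [[0, 1]], where [F] is bounded;
    empty cells receive [0]. *)
Let val (k : 'I_N) : H -> H :=
  if pselect (exists t, cell k t) is left _
  then ((k %% M)%:R / m - C)%:C *: F ((k %/ M)%:R / m) else 0.

Let cellP k t : cell k t -> [/\ t \in `[0%R, 1%R], (k %/ M)%:R <= m * t < (k %/ M)%:R + 1 &
   (k %% M)%:R <= m * (w t + C) < (k %% M)%:R + 1].
Proof. by move=> [tI [/= h1 h2]]; rewrite !in_itv /= -!natr1 in h1 h2. Qed.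

Let grid_in k t : cell k t -> (k %/ M)%:R / m \in `[0%R, 1%R].
Proof.
move=> /cellP[]; rewrite !in_itv /= => /andP[t0 t1] /andP[h1 _] _.
rewrite divr_ge0 ?ler0n ?(ltW m0)//= ler_pdivrMr// mul1r.
by apply: le_trans h1 _; rewrite ler_piMr// ltW.
Qed.

Let cell_sub k : cell k `<=` `[0%R, 1%R].
Proof. by move=> t []. Qed.

Let cell_measurable k : measurable (cell k : set (measurableTypeR R)).
Proof.
have -> : cell k = (I01 `&` (fun t => m * t) @^-1` `[(k %/ M)%:R, (k %/ M).+1%:R[) `&`
    (I01 `&` (fun t => m * (w t + C)) @^-1` `[(k %% M)%:R, (k %% M).+1%:R[).
  by rewrite setIACA setIid.
have mmt : measurable_fun I01 (fun t => m * t) by exact: measurable_funM.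
apply: measurableI.
  by apply: mmt => //; exact: measurable_itv.
have mwC : measurable_fun I01 (fun t => m * (w t + C)).
  by apply: measurable_funM => //; exact: measurable_funD.
by apply: mwC => //; exact: measurable_itv.
Qed.

Let val_bounded k : bounded_op (val k).
Proof.
rewrite /val; case: pselect => [[t ct]|_]; last exact: bounded_op0.
by apply: bounded_opZ; apply: bF; exact: grid_in ct.
Qed.

Let gs : op_simple H := OpSimple cell_sub cell_measurable val_bounded.

(** With [w'], [F'] the values at the node, [w F - w' F' = (w - w') F + w' (F - F')]. The first term
    costs [B / m], the second [(C + 1) L / m], since [w'] is within [1 / m <= 1] of [w t]. *)
Lemma grid_approximation : exists s : op_simple H, forall t x, t \in `[0%R, 1%R] ->
  nm (((w t)%:C *: F t - simple_fun s t) x) <= (B + (C + 1) * L) / m * nm x.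
Proof.
exists gs => t x tI; have [t0 t1] : 0 <= t /\ t <= 1.
  by move: tI; rewrite in_itv /= => /andP[].
have := wC tI; rewrite ler_norml => /andP[w0 w1].
have mt0 : 0 <= m * t by rewrite mulr_ge0// ltW.
have mw0 : 0 <= m * (w t + C) by rewrite mulr_ge0 ?(ltW m0)//; lra.
pose i := Num.trunc (m * t); pose j := Num.trunc (m * (w t + C)).
have iN : (i < n.+2)%N.
  rewrite truncn_lt_nat// -natr1 -/m.
  by apply: le_lt_trans (_ : m * 1 < _); rewrite ?ler_wpM2l ?(ltW m0)// mulr1 ltrDl.
have jM : (j < M)%N.
  by rewrite ltnS le_truncn// ler_wpM2l ?(ltW m0)//; lra.
have kN : (i * M + j < N)%N.
  by rewrite /N (leq_trans _ (_ : i.+1 * M <= _)%N)// ?leq_mul2r ?iN ?orbT// mulSn addnC ltn_add2r.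
pose k := Ordinal kN.
have kd : (k %/ M = i)%N by rewrite /= divnMDl// divn_small// addn0.
have km : (k %% M = j)%N by rewrite /= modnMDl modn_small.
have ck : cell k t.
  split=> //; split; rewrite /= in_itv /= ?kd ?km; exact: truncn_itv.
have cuniq k' : cell k' t -> k' = k.
  move=> [_ [/=]]; rewrite !in_itv /= => h1 h2; apply: val_inj => /=.
  by rewrite (divn_eq k' M) -(truncn_def h1) -(truncn_def h2).
rewrite subopE.
have -> : simple_fun gs t x = ((j%:R / m - C)%:C *: F (i%:R / m)) x.
  rewrite /simple_fun sumopE (bigD1 k)//= big1 ?addr0 => [|k' k'k].
    rewrite opE indicE mem_set// scale1r /val; case: pselect => [_|[]]; last by exists t.
    by rewrite kd km.
  rewrite opE indicE memNset ?scale0r// => /cuniq kk.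
  by rewrite kk eqxx in k'k.
have [_ /andP[i1 i2] /andP[j1 j2]] := cellP ck; rewrite kd in i1 i2; rewrite km in j1 j2.
have gI := grid_in ck; rewrite kd in gI.
have mi : m * m^-1 = 1 by rewrite mulfV// gt_eqF.
have m1 : m^-1 <= 1 by rewrite invf_le1// ler1n.
have mp : 0 < m^-1 by rewrite invr_gt0.
have wE : w t = m^-1 * (m * (w t + C)) - C by rewrite mulrA [_ * m]mulrC mi; ring.
have tE : t = m^-1 * (m * t) by rewrite mulrA [_ * m]mulrC mi mul1r.
have a1 : `|w t - (j%:R / m - C)| <= m^-1.
  rewrite wE opprB addrA subrK [j%:R / m]mulrC -mulrBr normrM (gtr0_norm mp).
  by rewrite ler_piMr ?(ltW mp)// ler_norml; apply/andP; split; lra.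
have a2 : `|t - i%:R / m| <= m^-1.
  rewrite {1}tE [i%:R / m]mulrC -mulrBr normrM (gtr0_norm mp).
  by rewrite ler_piMr ?(ltW mp)// ler_norml; apply/andP; split; lra.
have a3 : `|j%:R / m - C| <= C + 1.
  move: a1; rewrite !ler_norml; move: (j%:R / m - C) (m^-1) m1 => c q q1 /andP[c1 c2].
  by apply/andP; split; lra.
have -> : ((w t)%:C *: F t) x - ((j%:R / m - C)%:C *: F (i%:R / m)) x =
    (w t - (j%:R / m - C))%:C *: F t x + (j%:R / m - C)%:C *: ((F t - F (i%:R / m)) x).
  have gen (a c : R) (v v' : H) :
      a%:C *: v - c%:C *: v' = (a - c)%:C *: v + c%:C *: (v - v').
    by rewrite rmorphB /= scalerBl scalerBr addrA subrK.
  by rewrite !opE; exact: gen.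
apply: le_trans (nmD _ _) _; rewrite !nmZ.
have nx := nm_ge0 x.
have h1 : `|w t - (j%:R / m - C)| * nm (F t x) <= m^-1 * (B * nm x).
  by apply: ler_pM => //; [exact: nm_ge0|exact: FB].
have h2 : nm ((F t - F (i%:R / m)) x) <= L * `|t - i%:R / m| * nm x by exact: FL.
have {}h2 : nm ((F t - F (i%:R / m)) x) <= L * m^-1 * nm x.
  by apply: le_trans h2 _; rewrite ler_wpM2r// ler_wpM2l.
have h3 : `|j%:R / m - C| * nm ((F t - F (i%:R / m)) x) <= (C + 1) * (L * m^-1 * nm x).
  by apply: ler_pM => //; exact: nm_ge0.
apply: le_trans (lerD h1 h3) _.
by rewrite le_eqVlt; apply/orP; left; apply/eqP; ring.
Qed.

End grid.

Lemma op_integral_exists (w : R -> R) (F : R -> H -> H) (C B L : R) :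
  measurable_fun I01 w ->
  (forall t, t \in `[0%R, 1%R] -> `|w t| <= C) ->
  (forall t, t \in `[0%R, 1%R] -> bounded_op (F t)) ->
  (forall t x, t \in `[0%R, 1%R] -> nm (F t x) <= B * nm x) ->
  (forall (s t : R) (x : H), s \in `[0%R, 1%R] -> t \in `[0%R, 1%R] ->
    nm ((F t - F s) x) <= L * `|t - s| * nm x) ->
  0 <= C -> 0 <= B -> 0 <= L ->
  exists V, is_op_integral (fun t => (w t)%:C *: F t) V.
Proof.
move=> mw wC bF FB FL C0 B0 L0.
have ap n := grid_approximation mw wC bF FB FL L0 n.
pose s n := sval (cid (ap n)).
apply: (@op_integral_uniform_limit _ s (fun n => (B + (C + 1) * L) * harmonic n)).
- by move=> t tI; apply: bounded_opZ; exact: bF.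
- rewrite -[X in _ --> X](mulr0 (B + (C + 1) * L)); apply: cvgMr; exact: cvg_harmonic.
- by move=> n; rewrite mulr_ge0 ?invr_ge0// addr_ge0// mulr_ge0// addr_ge0.
- by move=> n t x tI; rewrite /s; case: cid => s' /= hs'; exact: hs'.
Qed.

End Existence.

(** * The weighted inequality *)

Section FormSup.
Context {R : realType} {H : hilbertType R}.
Implicit Types (x y : H) (S T : H -> H).

Lemma opnormN T : opnorm (- T) = opnorm T.
Proof.
by congr (sup _); apply/seteqP; split=> _ [x x1 <-]; exists x => //; rewrite opE normrN.
Qed.

(** Taken over the ball, not the sphere: the positive part of the top of the numerical range, well
    defined on the zero space too. *)
Definition form_sup T : R := sup [set rdot (T x) x | x in [set x | nm x <= 1]].

Lemma form_sup_has_sup T : bounded_op T ->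
  has_sup [set rdot (T x) x | x in [set x | nm x <= 1]].
Proof.
move=> bT; split; first by exists (rdot (T 0) 0), 0 => //=; rewrite nm0.
exists (opnorm T) => _ [x /= x1 <-].
apply: le_trans (rdot_le _ _) _.
apply: le_trans (ler_wpM2r (nm_ge0 x) (opnormP bT x)) _.
rewrite -mulrA ler_piMr ?opnorm_ge0// -[leRHS](mulr1 1).
by apply: ler_pM => //; exact: nm_ge0.
Qed.

Lemma form_supP T x : bounded_op T -> rdot (T x) x <= form_sup T * nm x ^+ 2.
Proof.
move=> bT; have [x0|x0] := eqVneq (nm x) 0.
  by rewrite x0 expr0n mulr0 (nm_eq0 x0) rdot0r.
have xp : 0 < nm x by rewrite lt_def x0 nm_ge0.
have xi : 0 <= (nm x)^-1 by rewrite invr_ge0 ltW.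
rewrite -ler_pdivrMr ?exprn_gt0//.
have -> : rdot (T x) x / nm x ^+ 2 = rdot (T ((nm x)^-1%:C *: x)) ((nm x)^-1%:C *: x).
  by rewrite (lopZ bT.1) rdotZl rdotZr; field.
apply: ub_le_sup; first by have [] := form_sup_has_sup bT.
exists ((nm x)^-1%:C *: x) => //=.
by rewrite nmZ ger0_norm// mulVf.
Qed.

Lemma form_sup_ge0 T : bounded_op T -> 0 <= form_sup T.
Proof.
move=> bT; apply: ub_le_sup; first by have [] := form_sup_has_sup bT.
by exists 0 => /=; rewrite ?nm0// rdot0r.
Qed.

Lemma form_sup_mono S T : bounded_op S -> bounded_op T ->
  (forall x, rdot (S x) x <= rdot (T x) x) -> form_sup S <= form_sup T.
Proof.
move=> bS bT ST; apply: ge_sup; first by have [] := form_sup_has_sup bS.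
move=> _ [x /= x1 <-]; apply: le_trans (ST x) _.
by apply: ub_le_sup; [have [] := form_sup_has_sup bT|exists x].
Qed.

(* The two suprema are monotone along a segment; this is what makes the operator norm of
   the derivative measurable. *)
Lemma opnorm_form_sup T : selfadjoint T ->
  opnorm T = Num.max (form_sup T) (form_sup (- T)).
Proof.
move=> sT; have [bT _] := sT; have bN := bounded_opN bT.
apply/eqP; rewrite eq_le; apply/andP; split.
  have m0 : 0 <= Num.max (form_sup T) (form_sup (- T)) by rewrite le_max form_sup_ge0.
  apply: opnorm_le => //; apply: selfadjoint_form_bound => // x.
  have x2 := sqr_ge0 (nm x).
  have h1 := form_supP x bT; have h2 := form_supP x bN.
  rewrite opE rdotNl in h2.
  have h3 : form_sup T * nm x ^+ 2 <= Num.max (form_sup T) (form_sup (- T)) * nm x ^+ 2.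
    by rewrite ler_wpM2r// le_max lexx.
  have h4 : form_sup (- T) * nm x ^+ 2 <= Num.max (form_sup T) (form_sup (- T)) * nm x ^+ 2.
    by rewrite ler_wpM2r// le_max lexx orbT.
  by rewrite ler_norml lerNl (le_trans h2 h4) (le_trans h1 h3).
have key (e : H -> H) : bounded_op e -> (forall x, nm (e x) = nm (T x)) -> form_sup e <= opnorm T.
  move=> be ne; apply: ge_sup; first by have [] := form_sup_has_sup be.
  move=> _ [x /= x1 <-]; apply: le_trans (rdot_le _ _) _; rewrite ne.
  apply: le_trans (ler_wpM2r (nm_ge0 x) (opnormP bT x)) _.
  rewrite -mulrA ler_piMr ?opnorm_ge0// -[leRHS](mulr1 1).
  by apply: ler_pM => //; exact: nm_ge0.
by rewrite ge_max !key// => x; rewrite opE nmN.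
Qed.

Lemma opnorm_psd T : selfadjoint T -> (forall x, 0 <= rdot (T x) x) -> opnorm T = form_sup T.
Proof.
move=> sT T0; rewrite opnorm_form_sup// max_l//; have [bT _] := sT.
apply: form_sup_mono => //; first exact: bounded_opN.
by move=> x; rewrite opE rdotNl; have := T0 x; lra.
Qed.

End FormSup.

(** * The inequality for a convex Lipschitz path [G] of selfadjoint operators with derivative [N] *)

Section Weighted.
Context {R : realType} {H : hilbertType R}.
Context (p : R -> R) (G N : R -> H -> H).
Implicit Types (x y : H) (t : R).
Local Notation mu := (@lebesgue_measure R).
Local Notation U := (`]0%R, 1%R[%classic : set (measurableTypeR R)).
Local Notation I01 := (`[0%R, 1%R]%classic : set (measurableTypeR R)).
Hypothesis p_sym : forall t, t \in `[0%R, 1%R] -> p (1 - t) = p t.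
Hypothesis p_incr : {in `[0%R, 2^-1] &, {homo p : s t / s <= t}}.
Hypothesis sG : forall t, selfadjoint (G t).
Hypothesis cG : forall x, unit_convex (fun t => rdot (G t x) x).
Hypothesis sN : forall t, t \in `[0%R, 1%R] -> selfadjoint (N t).
Hypothesis hN : forall x t, t \in `[0%R, 1%R] ->
  unit_slope (fun t => rdot (G t x) x) t (rdot (N t x) x).
Context (L : R) (L0 : 0 <= L).
Hypothesis GL : forall (s t : R) (x : H), s \in `[0%R, 1%R] -> t \in `[0%R, 1%R] ->
  nm ((G t - G s) x) <= L * `|t - s| * nm x.

Let I0 : 0 \in `[0%R, 1%R :> R]. Proof. by rewrite in_itv /= lexx ler01. Qed.

Let I1 : 1 \in `[0%R, 1%R :> R]. Proof. by rewrite in_itv /= lexx ler01. Qed.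

Let IU t : 0 < t < 1 -> t \in `[0%R, 1%R].
Proof. by move=> /andP[t0 t1]; rewrite in_itv /= !ltW. Qed.

Let I_onem t : t \in `[0%R, 1%R] -> 1 - t \in `[0%R, 1%R].
Proof. by rewrite !in_itv /= => /andP[? ?]; apply/andP; split; lra. Qed.

Let p_smono : smono p.
Proof.
split=> [t tI|s t s0 st th]; first by apply: p_sym; exact: IU.
by apply: p_incr => //; rewrite in_itv /=; apply/andP; split; lra.
Qed.

Let C := `|p 0| + `|p 2^-1|.

Let p_bound t : t \in `[0%R, 1%R] -> `|p t| <= C.
Proof.
have half t' : 0 <= t' -> t' <= 2^-1 -> `|p t'| <= C.
  move=> t0 th; have hh : 0 <= 2^-1 :> R by lra.
  have h1 : p 0 <= p t' by apply: p_incr => //; rewrite in_itv /= ?lexx ?t0 ?th ?hh.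
  have h2 : p t' <= p 2^-1 by apply: p_incr => //; rewrite in_itv /= ?lexx ?t0 ?th ?hh.
  have := ler_norm (- p 0); have := ler_norm (p 2^-1); rewrite normrN => h3 h4.
  have := normr_ge0 (p 0); have := normr_ge0 (p 2^-1) => h5 h6.
  by rewrite ler_norml /C; apply/andP; split; lra.
move=> tI; have := tI; rewrite in_itv /= => /andP[t0 t1].
have [th|th] := leP t 2^-1; first exact: half.
by rewrite -p_sym//; apply: half; lra.
Qed.

Let C0 : 0 <= C. Proof. exact: addr_ge0. Qed.

Let p_measurable : measurable_fun I01 p.
Proof.
apply: symmetric_monotone_measurable => [t tI|s t s0 st th].
  by apply: p_sym; rewrite in_itv.
by apply: p_incr => //; rewrite in_itv /=; apply/andP; split; lra.
Qed.

Let UI : U `<=` I01.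
Proof. by move=> t; rewrite /= !in_itv /= => /andP[/ltW-> /ltW->]. Qed.

Let bmf_closed (u : R -> R) (B : R) : measurable_fun I01 u -> 0 <= B ->
  (forall t, t \in `[0%R, 1%R] -> `|u t| <= B) -> bmf u.
Proof.
move=> m B0 hB; split; last by exists B => // t /IU; exact: hB.
by apply: measurable_funS m => //; exact: measurable_itv.
Qed.

Let bp : bmf p. Proof. exact: bmf_closed p_measurable C0 p_bound. Qed.

Let B := opnorm (G 0) + L.

Let B0 : 0 <= B. Proof. by rewrite addr_ge0// opnorm_ge0//; case: (sG 0). Qed.

Let GB t x : t \in `[0%R, 1%R] -> nm (G t x) <= B * nm x.
Proof.
move=> tI; have [bG _] := sG 0.
have -> : G t x = G 0 x + (G t - G 0) x by rewrite opE addrC subrK.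
apply: le_trans (nmD _ _) _; rewrite mulrDl lerD ?opnormP//.
apply: le_trans (GL x I0 tI) _; rewrite ler_wpM2r ?nm_ge0// ler_piMr// subr0.
by move: tI; rewrite in_itv /= => /andP[t0 t1]; rewrite ger0_norm.
Qed.

Let bG x y : bmf (fun t => rdot (G t x) y).
Proof.
split; last first.
  exists (B * nm x * nm y); first by rewrite !mulr_ge0 ?nm_ge0.
  move=> t tI; apply: le_trans (rdot_abs_le _ _) _.
  by rewrite ler_wpM2r ?nm_ge0// GB// IU.
apply: open_continuous_measurable_fun => [|t]; first exact: interval_open.
rewrite inE /= in_itv /= => tU; have [t0 t1] := andP tU.
apply/cvgrPdist_le => e e0; pose k := L * nm x * nm y.
have k0 : 0 <= k by rewrite !mulr_ge0 ?nm_ge0.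
have k1 : 0 < k + 1 by lra.
have r0 : 0 < Num.min (Num.min t (1 - t)) (e / (k + 1)).
  by rewrite !lt_min t0 subr_gt0 t1 divr_gt0.
exists (Num.min (Num.min t (1 - t)) (e / (k + 1))) => //= s /=.
rewrite /ball_ /= !lt_min => /andP[/andP[st0 st1] ste].
have sI : s \in `[0%R, 1%R].
  move: st0 st1; rewrite in_itv /= !ltr_norml => /andP[? ?] /andP[? ?].
  by apply/andP; split; lra.
rewrite -rdotBl -opE; apply: le_trans (rdot_abs_le _ _) _.
apply: le_trans (ler_wpM2r (nm_ge0 y) (GL x sI (IU tU))) _.
have -> : L * `|t - s| * nm x * nm y = k * `|t - s| by rewrite /k; ring.
move: ste; rewrite ltr_pdivlMr// => ste; apply: le_trans (ltW ste).
by rewrite mulrC ler_wpM2l// lerDl.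
Qed.

Let F t := G (1 - t).

Let bF x y : bmf (fun t => rdot (F t x) y).
Proof. exact: (bmf_onem (bG x y)). Qed.

Let FB t x : t \in `[0%R, 1%R] -> nm (F t x) <= B * nm x.
Proof. by move=> tI; apply: GB; exact: I_onem. Qed.

Let FL (s t : R) (x : H) : s \in `[0%R, 1%R] -> t \in `[0%R, 1%R] ->
  nm ((F t - F s) x) <= L * `|t - s| * nm x.
Proof.
move=> sI tI; apply: le_trans (GL x (I_onem sI) (I_onem tI)) _.
have -> // : `|1 - t - (1 - s)| = `|t - s|.
by rewrite -[in RHS]normrN; congr `|_|; ring.
Qed.

Let bounded_op_F t : t \in `[0%R, 1%R] -> bounded_op (F t).
Proof. by move=> _; case: (sG (1 - t)). Qed.

Let is_op_integral_F : is_op_integral F (op_integral F).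
Proof.
rewrite /op_integral; case: xgetP => [V _ //|h].
have n1 t : t \in `[0%R, 1%R :> R] -> `|cst (1 : R) t| <= 1 by move=> _ /=; rewrite normr1.
have m1 : measurable_fun I01 (cst (1 : R)) by exact: measurable_cst.
have [V hV] := op_integral_exists m1 n1
  bounded_op_F FB FL ler01 B0 L0.
case: (h V); rewrite /=; have <- // : (fun t => (cst 1 t)%:C *: F t) = F.
by apply/funext => t; rewrite scale1r.
Qed.

Let is_op_integral_pF : is_op_integral (fun t => (p t)%:C *: F t)
  (op_integral (fun t => (p t)%:C *: F t)).
Proof.
rewrite /op_integral; case: xgetP => [V _ //|h].
have [V hV] := op_integral_exists p_measurable p_bound bounded_op_F FB FL C0 B0 L0.
by case: (h V).
Qed.

Let rdot_F x y : rdot (op_integral F x) y = J (fun t => rdot (F t x) y).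
Proof. exact (op_integral_rdot is_op_integral_F (bF x y)). Qed.

Let rdot_pF x y : rdot (op_integral (fun t => (p t)%:C *: F t) x) y =
  J (fun t => p t * rdot (F t x) y).
Proof.
have E : (fun t => rdot (((p t)%:C *: F t) x) y) = (fun t => p t * rdot (F t x) y).
  by apply/funext => t; rewrite opE rdotZl.
rewrite -E; apply: (op_integral_rdot is_op_integral_pF); rewrite E.
exact: (bmfM bp (bF x y)).
Qed.

Definition cov_op : H -> H :=
  (\int[mu]_(t in `[0%R, 1%R]) p t)%:C *: op_integral (fun t => G (1 - t))
  - op_integral (fun t => (p t)%:C *: G (1 - t)).

Lemma selfadjoint_cov_op : selfadjoint cov_op.
Proof.
apply: selfadjointB; first apply: selfadjointZ; apply/selfadjointP.
- split; first by case: is_op_integral_F.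
  move=> x y; rewrite rdot_F rdotC rdot_F; apply: J_eq => t _.
  by have /selfadjointP[_ ->] := sG (1 - t); rewrite rdotC.
- split; first by case: is_op_integral_pF.
  move=> x y; rewrite rdot_pF rdotC rdot_pF; apply: J_eq => t _.
  by have /selfadjointP[_ ->] := sG (1 - t); rewrite rdotC.
Qed.

Lemma rdot_cov_op x : rdot (cov_op x) x =
  J p * J (fun t => rdot (G (1 - t) x) x) - J (fun t => p t * rdot (G (1 - t) x) x).
Proof.
rewrite /cov_op subopE scaleopE rdotBl rdotZl (J_Rintegral_cc bp).
exact (congr2 (fun a b => J p * a - b) (rdot_F x x) (rdot_pF x x)).
Qed.

Lemma cov_op_ge0 : op_le 0 cov_op.
Proof.
apply/op_leP; [exact: selfadjoint0|exact: selfadjoint_cov_op|move=> x].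
rewrite rdot0l rdot_cov_op.
exact: (cov_ge0 bp (bG x x) p_smono (cG x)).
Qed.

Hypothesis dp : forall t, t \in `]0%R, 1%R[ -> derivable p t 1.

Lemma cov_op_le_sup M : (forall t, 0 < t < 1 -> `|derive1 p t| <= M) ->
  op_le cov_op ((24^-1 * M)%:C *: (N 1 - N 0)).
Proof.
move=> hM; apply/op_leP; first exact: selfadjoint_cov_op.
  by apply: selfadjointZ; apply: selfadjointB; exact: sN.
move=> x; rewrite !opE rdotZl rdotBl rdot_cov_op.
have M0 : 0 <= M.
  by apply: le_trans (hM 2^-1 _); [exact: normr_ge0|apply/andP; split; lra].
have := cov_le bp (bG x x) p_smono (cG x) (derivable_osc dp hM)
  (convex_osc (d := fun t => rdot (N t x) x) (cG x) (hN x)).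
have := convex_slope_nondecreasing (d := fun t => rdot (N t x) x) (cG x) (hN x) I0 I1 ler01.
move: (J p * _ - _) (rdot (N 1 x) x) (rdot (N 0 x) x) => X d1 d0 d01 hX.
(* The sign matters: [1 / 32] can be enlarged to [1 / 24] only in front of a nonnegative
   quantity. *)
have d01' : 0 <= M * (d1 - d0) by rewrite mulr_ge0// subr_ge0.
by lra.
Qed.

Let eta t := opnorm (N (1 - t) - N t).

Let seta t : t \in `[0%R, 1%R] -> selfadjoint (N (1 - t) - N t).
Proof. by move=> tI; apply: selfadjointB; apply: sN => //; exact: I_onem. Qed.

Let Nmono (s t : R) x : 0 <= s -> s <= t -> t <= 1 -> rdot (N s x) x <= rdot (N t x) x.
Proof.
move=> s0 st t1.
have sI : s \in `[0%R, 1%R] by rewrite in_itv /= s0 (le_trans st).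
have tI : t \in `[0%R, 1%R] by rewrite in_itv /= t1 (le_trans s0).
exact: (convex_slope_nondecreasing (d := fun t => rdot (N t x) x) (cG x) (hN x)).
Qed.

Let eta_sym t : 0 <= t <= 1 -> eta (1 - t) = eta t.
Proof.
move=> tI; rewrite /eta opprB addrCA subrr addr0.
have -> : N t - N (1 - t) = - (N (1 - t) - N t) by rewrite opprB.
have s1 := seta (t := t); rewrite in_itv in s1; have {}s1 := s1 tI.
rewrite !opnorm_form_sup//; last exact: selfadjointN.
by rewrite opprK maxC.
Qed.

(** For [t <= 1/2] the gap [N (1 - t) - N t] is positive and shrinks in the operator order as [t]
    grows; on positive operators the norm is [form_sup], which respects that order. *)
Let eta_mono (s t : R) : 0 <= s -> s <= t -> t <= 2^-1 -> eta t <= eta s.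
Proof.
move=> s0 st th.
have sI : s \in `[0%R, 1%R] by rewrite in_itv /=; apply/andP; split; lra.
have tI : t \in `[0%R, 1%R] by rewrite in_itv /=; apply/andP; split; lra.
rewrite /eta !opnorm_psd; try exact: seta; last 2 first.
- by move=> x; rewrite opE rdotBl subr_ge0; apply: Nmono; lra.
- by move=> x; rewrite opE rdotBl subr_ge0; apply: Nmono; lra.
apply: form_sup_mono => [||x]; [by case: (seta tI)|by case: (seta sI)|].
rewrite !opE !rdotBl; have : rdot (N s x) x <= rdot (N t x) x by apply: Nmono; lra.
have : rdot (N (1 - t) x) x <= rdot (N (1 - s) x) x by apply: Nmono; lra.
by move=> ? ?; apply: lerB.
Qed.

Let eta_ge0 t : t \in `[0%R, 1%R] -> 0 <= eta t.
Proof. by move=> tI; apply: opnorm_ge0; case: (seta tI). Qed.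

Let eta_measurable : measurable_fun I01 eta.
Proof.
have : measurable_fun I01 (fun t => - eta t).
  apply: symmetric_monotone_measurable => [t tI|s t s0 st th].
    by rewrite eta_sym.
  by rewrite lerN2; exact: eta_mono.
by move/measurable_funN; apply: eq_measurable_fun => t _ /=; rewrite opprK.
Qed.

Let bounded_op_N t : t \in `[0%R, 1%R] -> bounded_op (N t).
Proof. by move=> tI; case: (sN tI). Qed.

Let nu t := opnorm (N t).

Let nuE t : t \in `[0%R, 1%R] -> nu t = Num.max (form_sup (N t)) (form_sup (- N t)).
Proof. by move=> tI; rewrite /nu opnorm_form_sup//; exact: sN. Qed.

Let nu_ge0 t : t \in `[0%R, 1%R] -> 0 <= nu t.
Proof. by move=> tI; apply: opnorm_ge0; exact: bounded_op_N. Qed.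

Let up_mono (s t : R) : 0 <= s -> s <= t -> t <= 1 -> form_sup (N s) <= form_sup (N t).
Proof.
move=> s0 st t1; apply: form_sup_mono => [||x]; last exact: Nmono.
- by apply: bounded_op_N; rewrite in_itv /= s0 (le_trans st).
- by apply: bounded_op_N; rewrite in_itv /= t1 (le_trans s0).
Qed.

Let down_mono (s t : R) : 0 <= s -> s <= t -> t <= 1 -> form_sup (- N t) <= form_sup (- N s).
Proof.
move=> s0 st t1; apply: form_sup_mono => [||x]; last first.
- by rewrite !oppopE !rdotNl lerN2; exact: Nmono.
- by apply/bounded_opN/bounded_op_N; rewrite in_itv /= s0 (le_trans st).
- by apply/bounded_opN/bounded_op_N; rewrite in_itv /= t1 (le_trans s0).
Qed.

(** The norm of [N t] need not be monotone in [t], but it is the maximum of a nondecreasing and a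
    nonincreasing function. *)
Let nu_measurable : measurable_fun I01 nu.
Proof.
have m1 := monotone_measurable up_mono.
have m2 : measurable_fun I01 (fun t => - form_sup (- N t)).
  by apply: monotone_measurable => s t s0 st t1; rewrite lerN2; exact: down_mono.
have := measurable_maxr m1 (measurable_funN m2).
apply: eq_measurable_fun => t tI; rewrite nuE//=; last by move: tI; rewrite inE.
by rewrite /= opprK.
Qed.

Let nu_bound t : t \in `[0%R, 1%R] -> nu t <= Num.max (form_sup (N 1)) (form_sup (- N 0)).
Proof.
move=> tI; have := tI; rewrite in_itv /= => /andP[t0 t1].
rewrite nuE// ge_max !le_max; apply/andP; split.
  by rewrite up_mono.
by rewrite [X in _ || X]down_mono ?orbT.
Qed.

Let bnu : bmf nu.
Proof.
apply: (bmf_closed nu_measurable (B := Num.max (form_sup (N 1)) (form_sup (- N 0)))).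
  by rewrite le_max form_sup_ge0//; exact: bounded_op_N.
by move=> t tI; rewrite ger0_norm ?nu_bound// nu_ge0.
Qed.

Let eta_le t : t \in `[0%R, 1%R] -> eta t <= nu (1 - t) + nu t.
Proof.
move=> tI; apply: opnormD_le => [||x]; [exact/bounded_op_N/I_onem|exact: bounded_op_N|].
by rewrite opE -(nmN (N t x)); exact: nmD.
Qed.

Let beta : bmf eta.
Proof.
apply: (bmf_closed eta_measurable (B := eta 0)); first exact: eta_ge0.
move=> t tI; rewrite ger0_norm ?eta_ge0//; have := tI; rewrite in_itv /= => /andP[t0 t1].
have [th|th] := leP t 2^-1; first exact: eta_mono.
by rewrite -eta_sym ?t0//; apply: eta_mono; lra.
Qed.

Let bmf_sqr u : bmf u -> bmf (fun t => u t ^+ 2).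
Proof. by move=> bu; exact: bmfM. Qed.

Lemma bmf_opnorm_sqr : bmf (fun t => opnorm (N t) ^+ 2).
Proof. exact: bmf_sqr bnu. Qed.

Lemma bmf_opnorm_gap_sqr : bmf (fun t => opnorm (N (1 - t) - N t) ^+ 2).
Proof. exact: bmf_sqr beta. Qed.

(** The triangle inequality and [(a + b)^2 <= 2 a^2 + 2 b^2]; the two resulting integrals agree by
    reflection. *)
Lemma J_opnorm_gap_le : J (fun t => opnorm (N (1 - t) - N t) ^+ 2) <=
  4 * J (fun t => opnorm (N t) ^+ 2).
Proof.
have b2 := bmf_sqr bnu; have b21 := bmf_onem b2.
have -> : 4 * J (fun t => nu t ^+ 2) =
    J (fun t => 2 * nu (1 - t) ^+ 2 + 2 * nu t ^+ 2).
  by rewrite JD ?JZ ?(J_onem b2)//; [ring|exact: bmfZ|exact: bmfZ].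
apply: J_le; [exact: bmf_sqr|by apply: bmfD; exact: bmfZ|].
move=> t /IU tI; have h1 := eta_le tI; have h2 := eta_ge0 tI.
have h3 : eta t ^+ 2 <= (nu (1 - t) + nu t) ^+ 2.
  by rewrite lerXn2r ?nnegrE// (le_trans h2).
have := sqr_ge0 (nu (1 - t) - nu t); move: h3.
by rewrite !expr2; lra.
Qed.

(** For fixed [x] the symmetrized form has slope at most [|x|^2 eta t], so [x] enters the bound only
    through [|x|^2]. The constant is [1/8] from [cov_le] times one [1/2] for each of the two
    oscillations. *)
Lemma cov_op_le_L2 : deriv_in_L2 p ->
  op_le cov_op ((32^-1 * deriv_norm2 p * Num.sqrt (J (fun t => opnorm (N (1 - t) - N t) ^+ 2)))%:C *: idfun).
Proof.
move=> [mdp dpoo]; apply/op_leP; first exact: selfadjoint_cov_op.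
  exact/selfadjointZ/selfadjoint_id.
move=> x; rewrite opE rdotZl rdotxx rdot_cov_op.
have mabs : measurable_fun U (fun t => `|derive1 p t|) by exact: measurableT_comp.
have oscp := slope_bound_osc p_smono.1 mabs (fun t _ => normr_ge0 _)
  (derivable_slope_bound dp) dpoo.
pose k := nm x ^+ 2; have k0 : 0 <= k by exact: sqr_ge0.
have beta2 := bmf_sqr beta.
have bh : bmf (fun t => k * eta t) by exact: bmfZ.
have bh2 := bmf_sqr bh.
have hh t : 0 < t < 1 -> `|rdot (N (1 - t) x) x - rdot (N t x) x| <= k * eta t.
  move=> /IU tI; rewrite -rdotBl -opE; apply: le_trans (rdot_abs_le _ _) _.
  rewrite /k expr2 mulrC -mulrA ler_wpM2l ?nm_ge0// mulrC.
  by apply: opnormP; case: (seta tI).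
have h0 t : 0 < t < 1 -> 0 <= k * eta t by move=> /IU tI; rewrite mulr_ge0// eta_ge0.
have hoo : (\int[mu]_(t in U) ((k * eta t) ^+ 2)%:E < +oo)%E.
  by apply: integrable_lty; [exact: mU|exact: (bmf_integrable bh2)].
have oscw := slope_bound_osc (convex_smono (cG x)).1 bh.1 h0
  (convex_slope_bound (d := fun t => rdot (N t x) x) (hN x) hh) hoo.
have := cov_le bp (bG x x) p_smono (cG x) oscp oscw.
have -> : fine (\int[mu]_(t in U) ((k * eta t) ^+ 2)%:E) = k ^+ 2 * J (fun t => eta t ^+ 2).
  rewrite -JZ//; congr fine; apply: eq_integral => t _.
  by rewrite exprMn.
rewrite sqrtrM ?sqr_ge0// sqrtr_sqr (ger0_norm k0) -/(deriv_norm2 p).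
move=> h; apply: le_trans h _; rewrite le_eqVlt; apply/orP; left; apply/eqP.
by rewrite /deriv_norm2 /Rintegral -/k; field.
Qed.

End Weighted.

Lemma pi_le4 (R : realType) : (pi : R) <= 4.
Proof. by have := pihalf_lt2 R; lra. Qed.

Lemma opath0 (R : realType) (H : hilbertType R) (A B : H -> H) : opath A B 0 = A.
Proof.
by apply/funext => x; rewrite /opath !opE subr0 scale1r scale0r addr0.
Qed.

Lemma opath1 (R : realType) (H : hilbertType R) (A B : H -> H) : opath A B 1 = B.
Proof.
by apply/funext => x; rewrite /opath !opE subrr scale0r scale1r add0r.
Qed.

Lemma opath_onem (R : realType) (H : hilbertType R) (A B : H -> H) (t : R) :
  opath A B (1 - t) = t%:C *: A + (1 - t)%:C *: B.
Proof. by rewrite /opath subKr. Qed.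

Theorem theorem4 (R : realType) (H : hilbertType R) (I : interval R)
    (f p : R -> R) (A B : H -> H)
    (f_convex : operator_convex I f) (SA_A : SA I A) (SA_B : SA I B)
    (p_sym : forall t, t \in `[0%R, 1%R] -> p (1 - t) = p t)
    (p_incr : {in `[0%R, 2^-1] &, {homo p : s t / s <= t}}) :
  let mu := @lebesgue_measure R in
  let F := fun t : R => cfc f (t%:C *: A + (1 - t)%:C *: B) in
  let nablaf := fun T : H -> H => nabla I (cfc f) T (B - A) in
  let D := (\int[mu]_(t in `[0%R, 1%R]) p t)%:C *: op_integral F
           - op_integral (fun t => (p t)%:C *: F t) in
  ((forall t, t \in `]0%R, 1%R[ -> derivable p t 1) ->
   gateaux_on I (cfc f) (segment A B) ->
   op_le 0 D /\
   (has_ubound (abs_deriv_values p) ->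
    op_le D ((24^-1 * sup (abs_deriv_values p))%:C *: (nablaf B - nablaf A))))
  /\
  ((forall t, t \in `]0%R, 1%R[ -> derivable p t 1) ->
   deriv_in_L2 p ->
   gateaux_on I (cfc f) (segment A B) ->
   (\int[mu]_(t in `[0%R, 1%R])
      (opnorm (nablaf ((1 - t)%:C *: A + t%:C *: B)) ^+ 2)%:E < +oo)%E ->
   let c1 := (2 * pi ^+ 2)^-1 * deriv_norm2 p *
     Num.sqrt (\int[mu]_(t in `[0%R, 1%R])
       (opnorm (nablaf ((1 - t)%:C *: A + t%:C *: B)
                - nablaf (t%:C *: A + (1 - t)%:C *: B)) ^+ 2)) in
   let c2 := (pi ^+ 2)^-1 * deriv_norm2 p *
     Num.sqrt (\int[mu]_(t in `[0%R, 1%R])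
       (opnorm (nablaf ((1 - t)%:C *: A + t%:C *: B)) ^+ 2)) in
   [/\ op_le 0 D, op_le D (c1%:C *: idfun) &
       op_le (c1%:C *: (idfun : H -> H)) (c2%:C *: idfun)]).
Proof.
move=> mu F nablaf D.
pose G := fpath f A B; pose N := npath I f A B.
have FE : F = fun t => G (1 - t).
  by apply/funext => t; rewrite /F /G /fpath opath_onem.
have DE : D = cov_op p G by rewrite /D FE.
have NE t : nablaf ((1 - t)%:C *: A + t%:C *: B) = N t by [].
have NE' t : nablaf (t%:C *: A + (1 - t)%:C *: B) = N (1 - t).
  by rewrite /N /npath opath_onem.
have N0E : nablaf A = N 0 := congr1 nablaf (esym (opath0 A B)).
have N1E : nablaf B = N 1 := congr1 nablaf (esym (opath1 A B)).
have sG t : selfadjoint (G t) by exact: selfadjoint_fpath SA_A SA_B t.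
have cG x : unit_convex (fun t => rdot (G t x) x).
  exact: fpath_convex f_convex SA_A SA_B x.
clearbody D nablaf F; subst D.
split=> [dp hG|dp dpL2 hG Noo c1 c2].
  have [L L0 GL] := fpath_lipschitz f_convex SA_A SA_B hG; rewrite -/G in GL.
  have sN t : t \in `[0%R, 1%R] -> selfadjoint (N t) by exact: selfadjoint_npath.
  have hN x t : t \in `[0%R, 1%R] ->
      unit_slope (fun t => rdot (G t x) x) t (rdot (N t x) x) by exact: npath_slope.
  clearbody G N; split; first exact (cov_op_ge0 p_sym p_incr sG cG L0 GL).
  move=> ub; rewrite N0E N1E.
  apply: (cov_op_le_sup p_sym p_incr sG cG sN hN L0 GL dp) => t tI.
  by apply: ub_le_sup => //; exists t; rewrite //= in_itv.
have [L L0 GL] := fpath_lipschitz f_convex SA_A SA_B hG; rewrite -/G in GL.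
have sN t : t \in `[0%R, 1%R] -> selfadjoint (N t) by exact: selfadjoint_npath.
have hN x t : t \in `[0%R, 1%R] ->
    unit_slope (fun t => rdot (G t x) x) t (rdot (N t x) x) by exact: npath_slope.
clearbody G N; have be := bmf_opnorm_gap_sqr cG sN hN; have bn := bmf_opnorm_sqr cG sN hN.
have le_gap := J_opnorm_gap_le cG sN hN.
have c1E : c1 = (2 * pi ^+ 2)^-1 * deriv_norm2 p *
    Num.sqrt (J (fun t => opnorm (N (1 - t) - N t) ^+ 2)).
  rewrite /c1 -(J_Rintegral_cc be); congr (_ * Num.sqrt _).
  (* The statement has [N t - N (1 - t)], the estimates its opposite; the norm is the same. *)
  by apply: eq_Rintegral => t _; rewrite NE NE' -opnormN opprB.
have c2E : c2 = (pi ^+ 2)^-1 * deriv_norm2 p * Num.sqrt (J (fun t => opnorm (N t) ^+ 2)).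
  rewrite /c2 -(J_Rintegral_cc bn); congr (_ * Num.sqrt _).
  by apply: eq_Rintegral => t _; rewrite NE.
have p0 : 0 <= deriv_norm2 p by exact: sqrtr_ge0.
have pi2 : 0 < pi ^+ 2 :> R by apply: exprn_gt0; exact: pi_gt0.
have sI c : selfadjoint (c%:C *: (idfun : H -> H)).
  by apply: selfadjointZ; exact: selfadjoint_id.
have le_id (a b : R) : a <= b -> op_le (a%:C *: (idfun : H -> H)) (b%:C *: idfun).
  move=> ab; apply/(op_leP (sI a) (sI b)) => x.
  by rewrite !opE !rdotZl rdotxx ler_wpM2r// sqr_ge0.
split; first exact (cov_op_ge0 p_sym p_incr sG cG L0 GL).
  move=> x; apply: le_trans (cov_op_le_L2 p_sym p_incr sG cG sN hN L0 GL dp dpL2 x) _.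
  apply: le_id; rewrite c1E -!mulrA ler_wpM2r ?mulr_ge0 ?sqrtr_ge0//.
  have pi22 : 0 < 2 * pi ^+ 2 :> R by exact: mulr_gt0.
  rewrite lef_pV2 ?posrE//.
  have : pi ^+ 2 <= 4 ^+ 2 :> R by rewrite lerXn2r ?nnegrE ?pi_ge0 ?pi_le4.
  by rewrite expr2; lra.
apply: le_id; rewrite c1E c2E invfM.
have : Num.sqrt (J (fun t => opnorm (N (1 - t) - N t) ^+ 2)) <=
    2 * Num.sqrt (J (fun t => opnorm (N t) ^+ 2)).
  (* The coefficient of [c2] is twice that of [c1]; under the root this [2] is the [4] of
     [J_opnorm_gap_le]. *)
  have -> : 2 = Num.sqrt 4 :> R.
    have -> : 4 = 2 ^+ 2 :> R by rewrite expr2; lra.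
    by rewrite sqrtr_sqr ger0_norm.
  by rewrite -sqrtrM// ler_wsqrtr.
have q0 : 0 <= (pi ^+ 2)^-1 * deriv_norm2 p by rewrite mulr_ge0// invr_ge0 ltW.
by move/(ler_wpM2l q0); lra.
Qed.
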